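(* Let $V,V'$ be $U_{q,q^{-1}}(\mathfrak g)$-modules in the category $\mathcal O$, where $q=r^{1/2}s^{-1/2}$, and let $V_{r,s},V'_{r,s}$ be the associated twisted $U_{r,s}(\mathfrak g)$-modules. Let $\hat R_{V,V'}\colon V\otimes V'\to V'\otimes V$ and $\hat R_{V_{r,s},V'_{r,s}}\colon V_{r,s}\otimes V'_{r,s}\to V'_{r,s}\otimes V_{r,s}$ be the standard intertwiners for $U_{q,q^{-1}}(\mathfrak g)$ and $U_{r,s}(\mathfrak g)$, respectively. Then $$\hat R_{V_{r,s},V'_{r,s}}=\xi_{V',V}\circ \hat R_{V,V'}\circ \xi_{V,V'}^{-1}.$$
   Context: $\mathbb K$ is an algebraically closed field, $r,s\in\mathbb K$ are transcendental with $rs^{-1}$ not a root of unity. Fractional powers of $r,s$ refer to fixed compatible systems of roots (homomorphisms $\mathbb Q\to\mathbb K^*$, $t\mapsto r^t,s^t$); $q=r^{1/2}s^{-1/2}$. $\mathfrak g$ is a simple finite-dimensional Lie algebra with simple roots $\alpha_1,\dots,\alpha_n$, root lattice $Q$, positive cone $Q^+$, weight lattice $P$, form $(\cdot,\cdot)$ normalized so that short roots have square length 2, Cartan matrix $a_{ij}=2(\alpha_i,\alpha_j)/(\alpha_i,\alpha_i)$, $d_i=\frac12(\alpha_i,\alpha_i)$, $r_i=r^{d_i}$, $s_i=s^{d_i}$. The Ringel form on $Q$ is the bilinear form with $\langle\alpha_i,\alpha_j\rangle=d_ia_{ij}$ for $i<j$, $d_i$ for $i=j$, $0$ for $i>j$,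 except that in type $D_n$ one sets $\langle\alpha_{n-1},\alpha_n\rangle=-1$, $\langle\alpha_n,\alpha_{n-1}\rangle=1$. It is extended to $P$ by $\mathbb Q$-bilinearity. $U_{r,s}(\mathfrak g)$ is the $\mathbb K$-algebra generated by $e_i,f_i,\omega_i^{\pm1},(\omega_i')^{\pm1}$ ($1\le i\le n$) with relations: the $\omega_i,\omega'_i$ commute and are invertible; $\omega_ie_j=r^{\langle\alpha_j,\alpha_i\rangle}s^{-\langle\alpha_i,\alpha_j\rangle}e_j\omega_i$, $\omega_if_j=r^{-\langle\alpha_j,\alpha_i\rangle}s^{\langle\alpha_i,\alpha_j\rangle}f_j\omega_i$, $\omega_i'e_j=r^{-\langle\alpha_i,\alpha_j\rangle}s^{\langle\alpha_j,\alpha_i\rangle}e_j\omega_i'$, $\omega_i'f_j=r^{\langle\alpha_i,\alpha_j\rangle}s^{-\langle\alpha_j,\alpha_i\rangle}f_j\omega_i'$; $[e_i,f_j]=\delta_{ij}\frac{\omega_i-\omega_i'}{r_i-s_i}$; and for $i\ne j$ the Serre relations $\sum_{k=0}^{1-a_{ij}}(-1)^k\binom{1-a_{ij}}{k}_{r_i,s_i}(r_is_i)^{k(k-1)/2}(rs)^{k\langle\alpha_j,\alpha_i\rangle}e_i^{1-a_{ij}-k}e_je_i^k=0$ and the same with $f_i^kf_jf_i^{1-a_{ij}-k}$ in place of the $e$-monomial. Here $[m]_{r,s}=\frac{r^m-s^m}{r-s}$, $[m]_{r,s}!=\prod_{k=1}^m[k]_{r,s}$ and $\binom mk_{r,s}=\frac{[m]_{r,s}!}{[k]_{r,s}![m-k]_{r,s}!}$.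 It is a Hopf algebra with $\omega_i,\omega_i'$ grouplike, $\Delta(e_i)=e_i\otimes1+\omega_i\otimes e_i$, $\Delta(f_i)=1\otimes f_i+f_i\otimes\omega_i'$. It is $Q$-graded by $\deg e_i=\alpha_i,\deg f_i=-\alpha_i,\deg\omega_i=\deg\omega'_i=0$. $U^{+},U^-$ are the subalgebras generated by the $e_i$, resp. the $f_i$; $U^{\ge}$ by $e_i,\omega_i^{\pm1}$; $U^{\le}$ by $f_i,(\omega'_i)^{\pm1}$. $U_{q,q^{-1}}(\mathfrak g)$ is the case $r=q,s=q^{-1}$. Hopf pairing: the unique non-degenerate bilinear $(\cdot,\cdot)\colon U_{r,s}^{\le}\times U_{r,s}^{\ge}\to\mathbb K$ with $(yy',x)=(y\otimes y',\Delta(x))$, $(y,xx')=(\Delta(y),x'\otimes x)$, $(f_i,\omega_j)=0=(\omega_i',e_j)$, $(f_i,e_j)=\delta_{ij}\frac1{s_i-r_i}$, $(\omega'_\lambda,\omega_\mu)=r^{\langle\lambda,\mu\rangle}s^{-\langle\mu,\lambda\rangle}$. For $\lambda,\mu\in P$ the symbol $(\omega_\lambda',\omega_\mu)$ denotes $r^{\langle\lambda,\mu\rangle}s^{-\langle\mu,\lambda\rangle}$; $\omega_i=\omega_{\alpha_i}$. A vector $v$ has weight $\lambda\in P$ if $\omega_iv=(\omega'_\lambda,\omega_i)v$ and $\omega_i'v=(\omega_i',\omega_\lambda)^{-1}v$ for all $i$; $V[\lambda]$ is the weight space. The category $\mathcal O$ consists of modules $V=\bigoplus_{\lambda\in P}V[\lambda]$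 with $\dim V[\lambda]<\infty$ and support contained in a finite union of sets $\mu-Q^+$, $\mu\in P$. Standard intertwiner: for $W_1,W_2\in\mathcal O$, $\hat R_{W_1,W_2}=\Theta\circ\tilde f\circ\tau\colon W_1\otimes W_2\to W_2\otimes W_1$, where $\tau$ is the flip, $\tilde f(w\otimes w')=(\omega'_{\mu'},\omega_{\mu})^{-1}w\otimes w'$ for $w,w'$ of weights $\mu,\mu'$, and $\Theta=\sum_{\mu\in Q^+}\sum_i y_i^\mu\otimes x_i^\mu$ with $\{x_i^\mu\},\{y_i^\mu\}$ dual bases of $U^+_{\mu},U^-_{-\mu}$ with respect to the Hopf pairing ($\Theta$-term for $\mu=0$ is $1\otimes 1$). Twisting: $\zeta\colon P\times P\to\mathbb K^*$ is the skew bicharacter $\zeta(\lambda,\mu)=\big(r^{\langle\mu,\lambda\rangle}s^{-\langle\lambda,\mu\rangle}q^{-(\lambda,\mu)}\big)^{1/2}=(rs)^{(\langle\mu,\lambda\rangle-\langle\lambda,\mu\rangle)/4}$. For a $U_{q,q^{-1}}(\mathfrak g)$-module $V=\bigoplus_\lambda V[\lambda]$, $V_{r,s}$ is the same vector space with the $U_{r,s}(\mathfrak g)$-action given, for $v\in V[\lambda]$, by $e_i\cdot v=\zeta(\alpha_i,\lambda)e_iv$, $f_i\cdot v=(r_is_i)^{-1/2}\zeta(\alpha_i,\lambda)f_iv$, $\omega_i\cdot v=(\omega_\lambda',\omega_i)v$, $\omega_i'\cdot v=(\omega_i',\omega_\lambda)^{-1}v$. For two such modules $V,V'$, the linear automorphism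 $\xi_{V,V'}$ of $V\otimes V'$ is $\xi_{V,V'}(v\otimes v')=\zeta(\lambda',\lambda)\,v\otimes v'$ for $v\in V[\lambda]$, $v'\in V'[\lambda']$. *)

(* Defs.v *)
From HB Require Import structures.
From mathcomp Require Import all_boot all_order all_algebra all_fingroup.
From mathcomp Require Import finmap generic_quotient ring_quotient.
From mathcomp Require Import boolp classical_sets functions cardinality fsbigop.
From mathcomp.multinomials Require Import monalg.

Set Implicit Arguments.
Unset Strict Implicit.
Unset Printing Implicit Defensive.

Import Order.TTheory GRing.Theory Num.Theory.

Local Open Scope classical_set_scope.
Local Open Scope ring_scope.
Local Open Scope quotient_scope.

Section Span.
Variables (K : fieldType) (V : lmodType K).
Implicit Type S : set V.

Inductive span S : V -> Prop :=
| span_nil : span S 0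
| span_cons a x y : S x -> span S y -> span S (a *: x + y).

Lemma span_gen S x : S x -> span S x.
Proof.
by move=> Sx; rewrite -[x]addr0 -[x]scale1r; apply: span_cons => //; left.
Qed.

Lemma spanD S x y : span S x -> span S y -> span S (x + y).
Proof.
move=> Sx Sy; elim: Sx => [|a u v Su _ IH]; first by rewrite add0r.
by rewrite -addrA; apply: span_cons.
Qed.

Lemma spanZ S c x : span S x -> span S (c *: x).
Proof.
elim=> [|a u v Su _ IH]; first by rewrite scaler0; left.
by rewrite scalerDr scalerA; apply: span_cons.
Qed.

Definition in_span S (x : V) : bool := `[< span S x >].

Lemma in_spanP S x : reflect (span S x) (in_span S x).
Proof. exact: asboolP. Qed.

Fact in_span_zmod_closed S : zmod_closed (in_span S).
Proof.
split=> [|x y /in_spanP Sx /in_spanP Sy]; first by apply/in_spanP; left.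
by apply/in_spanP/spanD => //; rewrite -scaleN1r; apply: spanZ.
Qed.

HB.instance Definition _ S :=
  GRing.isZmodClosed.Build V (in_span S) (in_span_zmod_closed S).

Definition quo S : Type :=
  Quotient.quot (GRing.ZmodClosed.clone V (in_span S) _).

HB.instance Definition _ S := GRing.Zmodule.on (quo S).
HB.instance Definition _ S :=
  EqQuotient.on (quo S).

Definition proj_quo S (x : V) : quo S := \pi_(quo S) x.

Lemma proj_quo_eq S x y : proj_quo S x = proj_quo S y <-> span S (x - y).
Proof.
rewrite /proj_quo; split; last first.
  by move=> h; apply/eqP; rewrite -Quotient.idealrBE; apply/in_spanP.
by move=> /eqP; rewrite -Quotient.idealrBE => /in_spanP.
Qed.

Lemma proj_quoD S : {morph proj_quo S : x y / x + y}.
Proof. by move=> x y; rewrite /proj_quo !piE. Qed.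

Lemma proj_quo_repr S (t : quo S) : proj_quo S (repr t) = t.
Proof. exact: reprK. Qed.

Lemma repr_proj_quo S x : span S (repr (proj_quo S x) - x).
Proof. by apply/proj_quo_eq; rewrite proj_quo_repr. Qed.

Definition quo_scale S (a : K) (t : quo S) : quo S := proj_quo S (a *: repr t).

Lemma quo_scale_proj S a x : quo_scale a (proj_quo S x) = proj_quo S (a *: x).
Proof.
by apply/proj_quo_eq; rewrite -scalerBr; apply/spanZ/repr_proj_quo.
Qed.

Fact quo_scaleA S a b (t : quo S) :
  quo_scale a (quo_scale b t) = quo_scale (a * b) t.
Proof. by rewrite -[t]proj_quo_repr !quo_scale_proj scalerA. Qed.

Fact quo_scale1 S : left_id 1 (@quo_scale S).
Proof. by move=> t; rewrite -[t]proj_quo_repr quo_scale_proj scale1r. Qed.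

Fact quo_scaleDr S : right_distributive (@quo_scale S) +%R.
Proof.
move=> a t u; rewrite -[t]proj_quo_repr -[u]proj_quo_repr -proj_quoD.
by rewrite !quo_scale_proj -proj_quoD scalerDr.
Qed.

Fact quo_scaleDl S (t : quo S) :
  {morph (@quo_scale S)^~ t : a b / a + b}.
Proof.
by move=> a b; rewrite -[t]proj_quo_repr !quo_scale_proj -proj_quoD scalerDl.
Qed.

HB.instance Definition _ S := GRing.Zmodule_isLmodule.Build K (quo S)
  (@quo_scaleA S) (@quo_scale1 S) (@quo_scaleDr S) (@quo_scaleDl S).

Fact proj_quo_linear S : linear (proj_quo S).
Proof. by move=> a x y; rewrite proj_quoD -quo_scale_proj. Qed.

HB.instance Definition _ S :=
  GRing.isLinear.Build K V (quo S) *:%R (proj_quo S) (@proj_quo_linear S).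

Definition is_basis (A : set V) m (b : 'I_m -> V) :=
  (forall i, A (b i)) /\
  (forall x, A x -> exists! c : 'rV[K]_m, x = \sum_i c 0 i *: b i).

End Span.

Section Tensor.
Variables (K : fieldType) (V W : lmodType K).
Implicit Type X : lmodType K.

Definition bilinear_map (X : lmodType K) (B : V -> W -> X) :=
  (forall w, linear (B^~ w)) /\ (forall v, linear (B v)).

Inductive tensor_rel : {malg K[(V * W)%type]} -> Prop :=
| tensor_rel_l a v1 v2 w :
    tensor_rel (<< (a *: v1 + v2, w) >> - (a *: << (v1, w) >> + << (v2, w) >>))
| tensor_rel_r a v w1 w2 :
    tensor_rel (<< (v, a *: w1 + w2) >> - (a *: << (v, w1) >> + << (v, w2) >>)).

Definition tensor := quo tensor_rel.

Definition tens (v : V) (w : W) : tensor := proj_quo tensor_rel << (v, w) >>.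

Definition free_lift (X : lmodType K) (B : V -> W -> X)
    (g : {malg K[(V * W)%type]}) : X :=
  \sum_(p <- msupp g) g@_p *: B p.1 p.2.

(** The linear map induced by [B : V -> W -> X], computed on a representative;
    it does not depend on the representative as soon as [B] is bilinear, see
    [tliftE] and [tlift_linear]. *)
Definition tlift (X : lmodType K) (B : V -> W -> X) (t : tensor) : X :=
  free_lift B (repr t).

Let free_lift_sub X (B : V -> W -> X) (g : {malg K[(V * W)%type]}) d :
  (msupp g `<=` d)%fset -> free_lift B g = \sum_(p <- d) g@_p *: B p.1 p.2.
Proof.
move=> sgd; rewrite /free_lift (big_fset_incl _ sgd) //= => p _ /mcoeff_outdom->.
by rewrite scale0r.
Qed.

Let free_lift_linear X (B : V -> W -> X) : linear (free_lift B).
Proof.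
move=> a g h; pose d := (msupp g `|` msupp h)%fset.
have sg : (msupp g `<=` d)%fset by apply: fsubsetUl.
have sh : (msupp h `<=` d)%fset by apply: fsubsetUr.
rewrite (free_lift_sub B sg) (free_lift_sub B sh) (@free_lift_sub _ _ _ d).
  rewrite scaler_sumr -big_split /=; apply: eq_bigr => p _.
  by rewrite mcoeffD mcoeffZ scalerDl scalerA.
apply: fsubset_trans (msuppD_le _ _) _; rewrite fsubUset sh andbT.
exact: fsubset_trans (msuppZ_le _ _) sg.
Qed.

Let free_lift_gen X (B : V -> W -> X) v w : free_lift B << (v, w) >> = B v w.
Proof.
by rewrite /free_lift msuppU oner_eq0 big_seq_fset1 mcoeffUU scale1r.
Qed.

Let free_lift_span X (B : V -> W -> X) g : bilinear_map B ->
  span tensor_rel g -> free_lift B g = 0.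
Proof.
move=> [Bl Br]; have L := free_lift_linear B.
have LD a x y : free_lift B (a *: x + y) = a *: free_lift B x + free_lift B y.
  exact: L.
have LN x y : free_lift B (x - y) = free_lift B x - free_lift B y.
  have -> : x - y = -1 *: y + x by rewrite scaleN1r addrC.
  by rewrite LD scaleN1r addrC.
elim=> [|a x y rx _ IH]; first by rewrite /free_lift msupp0 big_seq_fset0.
rewrite LD {}IH addr0; case: rx => [b v1 v2 w|b v w1 w2].
  by rewrite LN LD !free_lift_gen Bl subrr scaler0.
by rewrite LN LD !free_lift_gen Br subrr scaler0.
Qed.

Lemma tlift_proj (X : lmodType K) (B : V -> W -> X) g : bilinear_map B ->
  tlift B (proj_quo tensor_rel g) = free_lift B g.
Proof.
move=> bB; have /(free_lift_span bB) := repr_proj_quo tensor_rel g.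
rewrite addrC -scaleN1r free_lift_linear scaleN1r addrC => /eqP.
by rewrite subr_eq0 => /eqP.
Qed.

Lemma tliftE (X : lmodType K) (B : V -> W -> X) v w : bilinear_map B ->
  tlift B (tens v w) = B v w.
Proof. by move=> bB; rewrite /tens tlift_proj // free_lift_gen. Qed.

Lemma tlift_linear (X : lmodType K) (B : V -> W -> X) : bilinear_map B ->
  linear (tlift B).
Proof.
move=> bB a t u; rewrite -[t]proj_quo_repr -[u]proj_quo_repr -linearP.
by rewrite !tlift_proj // free_lift_linear.
Qed.

End Tensor.

Section TensorMaps.
Variable K : fieldType.

Definition flip (V W : lmodType K) : tensor V W -> tensor W V :=
  tlift (fun v w => tens w v).

Definition tmap (V W V' W' : lmodType K) (f : V -> V') (g : W -> W') :
    tensor V W -> tensor V' W' :=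
  tlift (fun v w => tens (f v) (g w)).

End TensorMaps.

(** Only meaningful when [f] is bijective. *)
Definition inverse_of (T : zmodType) (f : T -> T) (y : T) : T :=
  xget 0 [set x | f x = y].

Section FreeAlgebra.
Variables (K : fieldType) (T : choiceType).

Definition free_algebra : Type := {malg K[{fmonom T}]}.

HB.instance Definition _ := GRing.Lalgebra.on free_algebra.

Fact free_algebra_central c (x : {malg K[{fmonom T}]}) : x * (c *: 1) = c *: x.
Proof.
rewrite [x]monalgE mulr_suml scaler_sumr; apply: eq_bigr => m _.
have cU (d e : K) (m' : {fmonom T}) : << d * e *g m' >> = d *: << e *g m' >>.
  by apply/malgP => k; rewrite [RHS]mcoeffZ [LHS]mcoeffU [in RHS]mcoeffU mulrnAr.
have -> : c *: 1 = << c *g (fmone T : {fmonom T}) >> :> {malg K[{fmonom T}]}.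
  by rewrite -[c in RHS]mulr1 cU.
by rewrite malgM_def fgmulUU mulm1 mulrC cU.
Qed.

Fact free_algebra_scaleAr c (x y : free_algebra) : c *: (x * y) = x * (c *: y).
Proof.
have -> : c *: y = (c *: 1) * y by rewrite -scalerAl mul1r.
have -> : x * ((c *: 1) * y) = (c *: x) * y.
  by rewrite mulrA; congr (_ * _); apply: free_algebra_central.
exact: scalerAl.
Qed.

HB.instance Definition _ :=
  GRing.LSemiAlgebra_isSemiAlgebra.Build K free_algebra free_algebra_scaleAr.

Definition fgen (x : T) : free_algebra := << fmu x >>.

End FreeAlgebra.

Section PresentedAlgebra.
Variables (K : fieldType) (A : algType K) (rel : A -> A -> Prop).

(** The two-sided ideal generated by the relations [lhs = rhs] is the span of
    [ideal_gen]. *)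
Definition ideal_gen : set A :=
  [set x | exists a b lhs rhs, rel lhs rhs /\ x = a * (lhs - rhs) * b].

Definition palg : Type := quo ideal_gen.

HB.instance Definition _ := GRing.Lmodule.on palg.

Definition palg_proj (x : A) : palg := proj_quo ideal_gen x.
Local Notation pr := palg_proj.

Let ideal_mull a x : span ideal_gen x -> span ideal_gen (a * x).
Proof.
elim=> [|c y z [a1 [b1 [l [q [lq ->]]]]] _ IH]; first by rewrite mulr0; left.
rewrite mulrDr -scalerAr; apply: span_cons => //.
by exists (a * a1), b1, l, q; split=> //; rewrite !mulrA.
Qed.

Let ideal_mulr a x : span ideal_gen x -> span ideal_gen (x * a).
Proof.
elim=> [|c y z [a1 [b1 [l [q [lq ->]]]]] _ IH]; first by rewrite mul0r; left.
rewrite mulrDl -scalerAl; apply: span_cons => //.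
by exists a1, (b1 * a), l, q; split=> //; rewrite !mulrA.
Qed.

Definition palg_mul (x y : palg) : palg := pr (repr x * repr y).

Fact palg_mulE x y : palg_mul (pr x) (pr y) = pr (x * y).
Proof.
apply/proj_quo_eq; set x' := repr _; set y' := repr _.
have -> : x' * y' - x * y = (x' - x) * y' + x * (y' - y).
  by rewrite mulrBl mulrBr addrA subrK.
by apply: spanD; [apply/ideal_mulr/repr_proj_quo|apply/ideal_mull/repr_proj_quo].
Qed.

Fact palg_prK x : pr (repr x) = x. Proof. exact: proj_quo_repr. Qed.
Fact palg_prD x y : pr x + pr y = pr (x + y). Proof. by rewrite /pr proj_quoD. Qed.
Fact palg_prZ c x : c *: pr x = pr (c *: x). Proof. by rewrite /pr linearZ. Qed.

Fact palg_mulA : associative palg_mul.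
Proof.
by move=> x y z; rewrite -[x]palg_prK -[y]palg_prK -[z]palg_prK !palg_mulE mulrA.
Qed.
Fact palg_mul1 : left_id (pr 1) palg_mul.
Proof. by move=> x; rewrite -[x]palg_prK palg_mulE mul1r. Qed.
Fact palg_mulr1 : right_id (pr 1) palg_mul.
Proof. by move=> x; rewrite -[x]palg_prK palg_mulE mulr1. Qed.
Fact palg_mulDl : left_distributive palg_mul +%R.
Proof.
move=> x y z; rewrite -[x]palg_prK -[y]palg_prK -[z]palg_prK palg_prD.
by rewrite !palg_mulE palg_prD mulrDl.
Qed.
Fact palg_mulDr : right_distributive palg_mul +%R.
Proof.
move=> x y z; rewrite -[x]palg_prK -[y]palg_prK -[z]palg_prK palg_prD.
by rewrite !palg_mulE palg_prD mulrDr.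
Qed.
Fact palg_scaleAl (c : K) x y : c *: palg_mul x y = palg_mul (c *: x) y.
Proof.
rewrite -[x]palg_prK -[y]palg_prK palg_mulE !palg_prZ palg_mulE.
by rewrite scalerAl.
Qed.
Fact palg_scaleAr (c : K) x y : c *: palg_mul x y = palg_mul x (c *: y).
Proof.
rewrite -[x]palg_prK -[y]palg_prK palg_mulE !palg_prZ palg_mulE.
by rewrite scalerAr.
Qed.

(** A character of [A] compatible with the relations shows that [palg] is not
    the zero ring. *)
Fact palg_neq0 (eps : A -> K) :
  (forall x y, eps (x + y) = eps x + eps y) ->
  (forall x y, eps (x * y) = eps x * eps y) ->
  (forall c x, eps (c *: x) = c * eps x) -> eps 1 = 1 ->
  (forall l q, rel l q -> eps l = eps q) -> pr 1 != 0.
Proof.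
move=> epsD epsM epsZ eps1 eps_rel.
have eps0 : eps 0 = 0 by rewrite -(scale0r 1) epsZ mul0r.
apply/negP => /eqP; rewrite -[0](raddf0 (proj_quo ideal_gen)).
move=> /proj_quo_eq; rewrite subr0 => h.
suff : eps 1 = 0 by rewrite eps1 => /eqP; rewrite oner_eq0.
elim: h => [|c x y [a [b [l [q [lq ->]]]]] _ IH]; first exact: eps0.
rewrite epsD epsZ !epsM epsD -scaleN1r epsZ (eps_rel _ _ lq) mulN1r subrr.
by rewrite mulr0 mul0r mulr0 add0r.
Qed.

End PresentedAlgebra.

Inductive cartan_type : Type :=
| An of nat | Bn of nat | Cn of nat | Dn of nat | E6 | E7 | E8 | F4 | G2.

Definition dynkin_rank X : nat :=
  match X with
  | An n | Bn n | Cn n | Dn n => n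
  | E6 => 6 | E7 => 7 | E8 => 8 | F4 => 4 | G2 => 2
  end.

Definition cartan_type_wf X : bool :=
  match X with
  | An n => (1 <= n)%N
  | Bn n | Cn n => (2 <= n)%N
  | Dn n => (4 <= n)%N
  | _ => true
  end.

(** Nodes of Dynkin diagrams follow Bourbaki's labelling, shifted so that it
    starts at [0].  [bonds X] lists the edges, irrespective of multiplicity. *)
Definition bonds X : seq (nat * nat) :=
  let path_bonds n := [seq (k, k.+1) | k <- iota 0 n.-1] in
  match X with
  | Dn n => (n - 3, n.-1)%N :: path_bonds n.-1
  | E6 | E7 | E8 =>
      [:: (0, 2); (1, 3)]%N ++ [seq (k, k.+1) | k <- iota 2 (dynkin_rank X - 3)]
  | _ => path_bonds (dynkin_rank X)
  end.

(** [half_sqlen X k] is half the square length of the [k]-th simple root, the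
    short roots having square length [2]. *)
Definition half_sqlen X (k : nat) : nat :=
  match X with
  | Bn n => if (k < n.-1)%N then 2 else 1
  | Cn n => if (k < n.-1)%N then 1 else 2
  | F4 => if (k < 2)%N then 2 else 1
  | G2 => if k == 0%N then 1 else 3
  | _ => 1
  end.

(** The simple roots may be enumerated in any order, except in type [D], where
    the Ringel form refers to the standard labelling. *)
Record root_system := RootSystem {
  rs_type : cartan_type;
  rs_label : 'S_(dynkin_rank rs_type);
  rs_wf : cartan_type_wf rs_type;
  rs_std : if rs_type is Dn _ then rs_label = 1%g else True
}.

Section RootSystem.
Variable D : root_system.

Definition rk : nat := dynkin_rank (rs_type D).

Definition node (i : 'I_rk) : nat := rs_label D i.

Definition dd (i : 'I_rk) : nat := half_sqlen (rs_type D) (node i).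

(** Two adjacent simple roots have scalar product minus half the square length
    of the longer one. *)
Definition sform (i j : 'I_rk) : rat :=
  if i == j then (dd i * 2)%:R
  else if ((node i, node j) \in bonds (rs_type D))
       || ((node j, node i) \in bonds (rs_type D))
  then - (maxn (dd i) (dd j))%:R
  else 0.

Definition cartan (i j : 'I_rk) : rat := 2 * sform i j / sform i i.

(** The rational span of the root lattice, in coordinates with respect to the
    simple roots; [P] ([wlattice]), [Q] and [Q^+] are subsets of it. *)
Definition wvec := 'rV[rat]_rk.

Definition alpha (i : 'I_rk) : wvec := delta_mx 0 i.

Definition form (x y : wvec) : rat := \sum_i \sum_j x 0 i * y 0 j * sform i j.

Definition wlattice : set wvec :=
  [set x | forall i,
     2 * form x (alpha i) / form (alpha i) (alpha i) \is a Num.int].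

(** Elements of [Q^+], and of [Q], given by their coordinates. *)
Definition qplus := {ffun 'I_rk -> nat}.
Definition qvec (b : qplus) : wvec := \row_i (b i)%:R.
Definition qlat := {ffun 'I_rk -> int}.
Definition qlvec (b : qlat) : wvec := \row_i (b i)%:~R.

Definition ringel_generic (i j : 'I_rk) : rat :=
  if (i < j)%N then (dd i)%:R * cartan i j
  else if i == j then (dd i)%:R else 0.

Definition ringel_simple (i j : 'I_rk) : rat :=
  match rs_type D with
  | Dn n =>
      if (i == n - 2 :> nat)%N && (j == n.-1 :> nat) then -1
      else if (i == n.-1 :> nat) && (j == n - 2 :> nat)%N then 1
      else ringel_generic i j
  | _ => ringel_generic i j
  end.

Definition ringel (x y : wvec) : rat :=
  \sum_i \sum_j x 0 i * y 0 j * ringel_simple i j.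

End RootSystem.

(** Generators: [ge i], [gf i], and [gw p b i], which stands for [omega_i]
    ([p = false]) or [omega'_i] ([p = true]), inverted when [b = true]. *)
Inductive gen (n : nat) : Type :=
| ge of 'I_n | gf of 'I_n | gw of bool & bool & 'I_n.

HB.instance Definition _ n := gen_eqMixin (gen n).
HB.instance Definition _ n := gen_choiceMixin (gen n).

Section QuantumNumbers.
Variables (K : fieldType) (a b : K).
Definition qnat (m : nat) : K := (a ^+ m - b ^+ m) / (a - b).
Definition qfact (m : nat) : K := \prod_(1 <= k < m.+1) qnat k.
Definition qbin (m k : nat) : K := qfact m / (qfact k * qfact (m - k)).
End QuantumNumbers.

(** A compatible system of roots of [x]: [e t] plays the role of [x ^ t]. *)
Definition power_system (K : fieldType) (x : K) (e : rat -> K) :=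
  (forall t u, e (t + u) = e t * e u) /\ e 1 = x.

(** Transcendence over the prime field of [K], in any characteristic. *)
Definition transcendental (K : fieldType) (x : K) :=
  forall p : {poly int},
    map_poly intr p != 0 :> {poly K} -> ~~ root (map_poly intr p) x.

(** From now on [r] and [s] are systems of powers, [r t] and [s t] standing for
    [r ^ t] and [s ^ t]. *)
Section QuantumGroup.
Variables (K : fieldType) (D : root_system) (r s : rat -> K).
Local Notation n := (rk D).
Local Notation rg := (@ringel D).
Local Notation al := (@alpha D).

(** The scalar [(omega'_x, omega_y)]. *)
Definition ompair (x y : wvec D) : K := r (rg x y) * s (- rg y x).

Definition ri (i : 'I_n) : K := r (dd i)%:R.
Definition si (i : 'I_n) : K := s (dd i)%:R.

Definition serre_exp (i j : 'I_n) : nat := Num.trunc (1 - cartan i j).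

Definition serre_coef (i j : 'I_n) (k : nat) : K :=
  (-1) ^+ k * qbin (ri i) (si i) (serre_exp i j) k
  * (ri i * si i) ^+ (k * k.-1)./2
  * (r (k%:R * rg (al j) (al i)) * s (k%:R * rg (al j) (al i))).

Definition uq_counit_gen (x : gen n) : K := if x is gw _ _ _ then 1 else 0.

Section Relations.
Variables (A : algType K) (g : gen n -> A).

Local Notation e i := (g (ge i)).
Local Notation f i := (g (gf i)).
Local Notation w i := (g (gw false false i)).
Local Notation w' i := (g (gw true false i)).

Inductive uq_rel : A -> A -> Prop :=
| rel_ww p p' b b' i j :
    uq_rel (g (gw p b i) * g (gw p' b' j)) (g (gw p' b' j) * g (gw p b i))
| rel_winv p i : uq_rel (g (gw p false i) * g (gw p true i)) 1
| rel_we i j :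
    uq_rel (w i * e j)
      ((r (rg (al j) (al i)) * s (- rg (al i) (al j))) *: (e j * w i))
| rel_wf i j :
    uq_rel (w i * f j)
      ((r (- rg (al j) (al i)) * s (rg (al i) (al j))) *: (f j * w i))
| rel_w'e i j :
    uq_rel (w' i * e j)
      ((r (- rg (al i) (al j)) * s (rg (al j) (al i))) *: (e j * w' i))
| rel_w'f i j :
    uq_rel (w' i * f j)
      ((r (rg (al i) (al j)) * s (- rg (al j) (al i))) *: (f j * w' i))
| rel_ef i j :
    uq_rel (e i * f j - f j * e i)
      (if i == j then (ri i - si i)^-1 *: (w i - w' i) else 0)
| rel_serre_e i j : i != j ->
    uq_rel (\sum_(k < (serre_exp i j).+1)
              serre_coef i j k *: (e i ^+ (serre_exp i j - k) * e j * e i ^+ k)) 0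
| rel_serre_f i j : i != j ->
    uq_rel (\sum_(k < (serre_exp i j).+1)
              serre_coef i j k *: (f i ^+ k * f j * f i ^+ (serre_exp i j - k))) 0.

Fact uq_rel_counit (eps : A -> K) :
  (forall x y, eps (x + y) = eps x + eps y) ->
  (forall x y, eps (x * y) = eps x * eps y) ->
  (forall c x, eps (c *: x) = c * eps x) -> eps 1 = 1 ->
  (forall x, eps (g x) = uq_counit_gen x) ->
  forall l q, uq_rel l q -> eps l = eps q.
Proof.
move=> epsD epsM epsZ eps1 epsg.
have eps0 : eps 0 = 0 by rewrite -(scale0r 1) epsZ mul0r.
have epsN x : eps (- x) = - eps x by rewrite -scaleN1r epsZ mulN1r.
have eps_sum m (F : 'I_m -> A) : (forall i, eps (F i) = 0) ->
    eps (\sum_(i < m) F i) = 0.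
  by move=> F0; elim/big_rec: _ => [|i x _ x0]; rewrite ?eps0 // epsD F0 x0 addr0.
move=> l q; case=> [p p' b b' i j|p i|i j|i j|i j|i j|i j|i j _|i j _].
- by rewrite !epsM mulrC.
- by rewrite !epsM !epsg eps1 mulr1.
- by rewrite epsZ !epsM !epsg !(mulr0, mul0r).
- by rewrite epsZ !epsM !epsg !(mulr0, mul0r).
- by rewrite epsZ !epsM !epsg !(mulr0, mul0r).
- by rewrite epsZ !epsM !epsg !(mulr0, mul0r).
- rewrite epsD epsN !epsM !epsg !(mulr0, mul0r) subr0; case: eqP => _.
    by rewrite epsZ epsD epsN !epsg subrr mulr0.
  by rewrite eps0.
- by rewrite eps0 eps_sum // => k; rewrite epsZ !epsM !epsg /= !(mulr0, mul0r).
- by rewrite eps0 eps_sum // => k; rewrite epsZ !epsM !epsg /= !(mulr0, mul0r).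
Qed.

End Relations.

Local Notation FA := (free_algebra K (gen n)).

Definition uq_free_rel : FA -> FA -> Prop :=
  uq_rel (@fgen K (gen n)).

Definition uq_counit_word (m : {fmonom gen n}) : K :=
  \prod_(x <- (m : seq _)) uq_counit_gen x.

Fact uq_counit_word_morph : mmorphism uq_counit_word.
Proof.
split=> [x y|]; rewrite /uq_counit_word; first by rewrite fmM big_cat.
by rewrite fm1 big_nil.
Qed.

HB.instance Definition _ :=
  isMultiplicative.Build {fmonom gen n} K uq_counit_word uq_counit_word_morph.

Definition uq_counit (x : FA) : K := mmap idfun uq_counit_word x.

Fact uq_counitD x y : uq_counit (x + y) = uq_counit x + uq_counit y.
Proof. exact: mmapD. Qed.
Fact uq_counitZ c x : uq_counit (c *: x) = c * uq_counit x.
Proof. exact: mmapZ. Qed.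
Fact uq_counitM x y : uq_counit (x * y) = uq_counit x * uq_counit y.
Proof. exact: (rmorphM (mmap idfun uq_counit_word)). Qed.
Fact uq_counit1 : uq_counit 1 = 1. Proof. exact: mmap1. Qed.
Fact uq_counitg x : uq_counit (fgen K x) = uq_counit_gen x.
Proof. by rewrite /uq_counit mmapU mul1r /uq_counit_word fmU big_seq1. Qed.

Definition Uq : Type := palg uq_free_rel.

HB.instance Definition _ := GRing.Lmodule.on Uq.
HB.instance Definition _ := GRing.Zmodule_isNzRing.Build Uq
  (@palg_mulA _ _ uq_free_rel) (@palg_mul1 _ _ uq_free_rel)
  (@palg_mulr1 _ _ uq_free_rel) (@palg_mulDl _ _ uq_free_rel)
  (@palg_mulDr _ _ uq_free_rel)
  (palg_neq0 uq_counitD uq_counitM uq_counitZ uq_counit1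
     (uq_rel_counit uq_counitD uq_counitM uq_counitZ uq_counit1 uq_counitg)).
HB.instance Definition _ :=
  GRing.LSemiModule_isLSemiAlgebra.Build K Uq (@palg_scaleAl _ _ uq_free_rel).
HB.instance Definition _ :=
  GRing.LSemiAlgebra_isSemiAlgebra.Build K Uq (@palg_scaleAr _ _ uq_free_rel).

Definition uq_gen (x : gen n) : Uq := palg_proj uq_free_rel (fgen K x).

End QuantumGroup.

Section HopfStructure.
Variables (K : fieldType) (D : root_system) (r s : rat -> K).
Local Notation n := (rk D).
Local Notation U := (Uq D r s).

Definition ue (i : 'I_n) : U := uq_gen r s (ge i).
Definition uf (i : 'I_n) : U := uq_gen r s (gf i).
Definition uw (p b : bool) (i : 'I_n) : U := uq_gen r s (gw p b i).

(** [uomega false l] is [omega_l] and [uomega true l] is [omega'_l]. *)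
Definition uomega (p : bool) (l : qlat D) : U :=
  \prod_i match l i with
          | Posz k => uw p false i ^+ k
          | Negz k => uw p true i ^+ k.+1
          end.

Definition uword (w : seq (gen n)) : U := \prod_(x <- w) uq_gen r s x.

(** The subalgebra generated by a set of generators, and its homogeneous
    component of degree [b] for the [Q]-grading of [U]. *)
Definition usub (G : set (gen n)) : set U :=
  span [set u | exists w, (forall x, x \in w -> G x) /\ u = uword w].

Definition gen_deg (x : gen n) : wvec D :=
  match x with ge i => alpha i | gf i => - alpha i | gw _ _ _ => 0 end.

Definition usub_deg (G : set (gen n)) (b : wvec D) : set U :=
  span [set u | exists w, [/\ forall x, x \in w -> G x,
                              \sum_(x <- w) gen_deg x = b & u = uword w]].

Definition gens_e : set (gen n) := [set x | exists i, x = ge i].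
Definition gens_f : set (gen n) := [set x | exists i, x = gf i].
Definition gens_ge : set (gen n) :=
  gens_e `|` [set x | exists b i, x = gw false b i].
Definition gens_le : set (gen n) :=
  gens_f `|` [set x | exists b i, x = gw true b i].

Definition tmul (t u : tensor U U) : tensor U U :=
  tlift (fun a b => tlift (fun c d => tens (a * c) (b * d)) u) t.

Record is_coproduct (cop : U -> tensor U U) : Prop := IsCoproduct {
  cop_linear : linear cop;
  cop1 : cop 1 = tens 1 1;
  copM : forall x y, cop (x * y) = tmul (cop x) (cop y);
  cop_w : forall p b i, cop (uw p b i) = tens (uw p b i) (uw p b i);
  cop_e : forall i, cop (ue i) = tens (ue i) 1 + tens (uw false false i) (ue i);
  cop_f : forall i, cop (uf i) = tens 1 (uf i) + tens (uf i) (uw true false i)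
}.

Definition Kmod : lmodType K := K^o.

(** [(y (x) y', t)] and [(t, x (x) x')], for [t] in [U (x) U]. *)
Definition tpair_l (B : U -> U -> Kmod) (y y' : U) (t : tensor U U) : Kmod :=
  tlift (fun a b => (B y a * B y' b : Kmod)) t.
Definition tpair_r (B : U -> U -> Kmod) (t : tensor U U) (x x' : U) : Kmod :=
  tlift (fun a b => (B a x * B b x' : Kmod)) t.

(** The Hopf pairing lives on [U^<= x U^>=]; it is represented by any bilinear
    form [B] on [U x U] extending it, and only the restriction of [B] to
    [U^<= x U^>=] is constrained (and used). *)
Record is_hopf_pairing (cop : U -> tensor U U) (B : U -> U -> Kmod) : Prop :=
    IsHopfPairing {
  hp_bilinear : bilinear_map B;
  hp_nondeg_l : forall y, usub gens_le y ->
    (forall x, usub gens_ge x -> B y x = 0) -> y = 0;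
  hp_nondeg_r : forall x, usub gens_ge x ->
    (forall y, usub gens_le y -> B y x = 0) -> x = 0;
  hp_mul_l : forall y y' x, usub gens_le y -> usub gens_le y' ->
    usub gens_ge x -> B (y * y') x = tpair_l B y y' (cop x);
  hp_mul_r : forall y x x', usub gens_le y -> usub gens_ge x ->
    usub gens_ge x' -> B y (x * x') = tpair_r B (cop y) x' x;
  hp_fw : forall i j, B (uf i) (uw false false j) = 0;
  hp_we : forall i j, B (uw true false i) (ue j) = 0;
  hp_fe : forall i j, B (uf i) (ue j) = (i == j)%:R / (si s i - ri r i);
  hp_ww : forall l m : qlat D,
    B (uomega true l) (uomega false m) = ompair r s (qlvec l) (qlvec m)
}.

(** The coproduct and the Hopf pairing of [U], which are determined by their
    defining properties, together with a choice, for each [b] in [Q^+], of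
    bases of [U^+_b] and [U^-_{-b}] dual to each other. *)
Record hopf_data := HopfData {
  hd_cop : U -> tensor U U;
  hd_copP : is_coproduct hd_cop;
  hd_pair : U -> U -> Kmod;
  hd_pairP : is_hopf_pairing hd_cop hd_pair;
  hd_dim : qplus D -> nat;
  hd_x : forall b, 'I_(hd_dim b) -> U;
  hd_y : forall b, 'I_(hd_dim b) -> U;
  hd_xP : forall b, is_basis (usub_deg gens_e (qvec b)) (@hd_x b);
  hd_yP : forall b, is_basis (usub_deg gens_f (- qvec b)) (@hd_y b);
  hd_dual : forall b i j, hd_pair (@hd_y b i) (@hd_x b j) = (i == j)%:R
}.

Record uq_module (V : lmodType K) := UqModule {
  uact : U -> V -> V;
  uact_linl : forall v, linear (uact^~ v);
  uact_linr : forall u, linear (uact u);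
  uact1 : forall v, uact 1 v = v;
  uactM : forall u u' v, uact (u * u') v = uact u (uact u' v)
}.

Section Weights.
Variables (V : lmodType K) (M : uq_module V).

Definition wt_space (l : wvec D) : set V :=
  [set v | forall i,
     uact M (uw false false i) v = ompair r s l (alpha i) *: v /\
     uact M (uw true false i) v = (ompair r s (alpha i) l)^-1 *: v].

Definition wt_decomposition (v : V) (c : wvec D -> V) :=
  [/\ finite_set [set l | c l != 0],
      forall l, wlattice l -> wt_space l (c l),
      forall l, ~ wlattice l -> c l = 0
    & v = \sum_(l \in @wlattice D) c l].

Definition in_category_O :=
  [/\ forall v, exists! c, wt_decomposition v c,
      forall l, wlattice l ->
        exists b : seq V, wt_space l `<=` span [set v | v \in b]
    & exists2 mu : seq (wvec D), (forall m, m \in mu -> wlattice m) &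
        forall l v, wlattice l -> wt_space l v -> v != 0 ->
          exists2 m, m \in mu & exists b : qplus D, l = m - qvec b].

Definition wt_comp (l : wvec D) (v : V) : V :=
  xget 0 [set x | exists2 c, wt_decomposition v c & x = c l].

End Weights.

(** The map acting on the tensor product of the weight spaces of weights [l] and
    [m] as multiplication by [c l m]. *)
Definition wt_scaling (V W : lmodType K) (M : uq_module V) (N : uq_module W)
    (c : wvec D -> wvec D -> K) : tensor V W -> tensor V W :=
  tlift (fun v w => \sum_(l \in @wlattice D) \sum_(m \in @wlattice D)
                      c l m *: tens (wt_comp M l v) (wt_comp N m w)).

Section Intertwiner.
Variables (H : hopf_data) (V W : lmodType K).

(** The sum has finite support on every tensor when [N] is in category O. *)
Definition Theta (M : uq_module V) (N : uq_module W) (t : tensor V W) :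
    tensor V W :=
  \sum_(b \in [set: qplus D])
    \sum_(i < hd_dim H b) tmap (uact M (@hd_y H b i)) (uact N (@hd_x H b i)) t.

Definition ftilde (M : uq_module V) (N : uq_module W) :
    tensor V W -> tensor V W :=
  wt_scaling M N (fun m m' => (ompair r s m' m)^-1).

End Intertwiner.

Definition Rhat (H : hopf_data) (V W : lmodType K) (M : uq_module V)
    (N : uq_module W) : tensor V W -> tensor W V :=
  Theta H N M \o ftilde N M \o @flip K V W.

End HopfStructure.

Section Twist.
Variables (K : fieldType) (D : root_system) (r s : rat -> K).

(** The powers of [q = r^{1/2} s^{-1/2}] and of [q^{-1}]. *)
Definition qpow (t : rat) : K := r (t / 2) * s (- (t / 2)).
Definition qinvpow (t : rat) : K := qpow (- t).

Definition zeta (l m : wvec D) : K :=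
  let c := (ringel m l - ringel l m) / 4 in r c * s c.

(** [M'] is the module [V_{r,s}] attached to the U_{q,q^{-1}}(g)-module [M]. *)
Definition is_twist (V : lmodType K) (M : uq_module D qpow qinvpow V)
    (M' : uq_module D r s V) :=
  forall (l : wvec D) (v : V) (i : 'I_(rk D)), wlattice l -> wt_space M l v ->
  [/\ uact M' (ue r s i) v = zeta (alpha i) l *: uact M (ue _ _ i) v,
      uact M' (uf r s i) v
        = (r (- (dd i)%:R / 2) * s (- (dd i)%:R / 2) * zeta (alpha i) l)
          *: uact M (uf _ _ i) v,
      uact M' (uw r s false false i) v = ompair r s l (alpha i) *: v
    & uact M' (uw r s true false i) v = (ompair r s (alpha i) l)^-1 *: v].

Definition xi (V V' : lmodType K) (M : uq_module D qpow qinvpow V)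
    (M' : uq_module D qpow qinvpow V') : tensor V V' -> tensor V V' :=
  wt_scaling M M' (fun l l' => zeta l' l).

End Twist.

(* Main.v *)
(** A word [e_w = e_i1 ... e_ik] of weight [b] acts on a vector of weight [l] of
    the twisted module as [zeta b l * c(w)] times the action of the same word on
    the original module, where [c(w)] is the product of the
    [zeta alpha_ij alpha_il] over [j < l]; words in the [f_i] behave in the same
    way, with [c(w)^-1] and the factors [(r_i s_i)^(-1/2)].  Each [f_i] pairs with
    the positive part as a skew derivation, so the Hopf pairing on words is given
    by a recursion whose only input is the pairing of the Cartan parts and of
    [f_i] with [e_i]; comparing the recursions for [U_{r,s}] and [U_{q,q^-1}]
    shows that the rescaling of words above preserves the pairings.  As these are
    non-degenerate in each degree, the rescaling identifies the canonical elements
    [Theta_b], up to the factor [zeta b l' * zeta b l] left over by the weights of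
    the vectors they act on.  The theorem is then an identity between scalars.

    Finally, [V] and [V_{r,s}] have the same weight spaces: by the absence of roots
    of unity, two weights with the same [(r,s)]-character have the same
    [q]-character, hence coincide if their weight spaces are nonzero, the
    decomposition of [V] being direct. *)

From HB Require Import structures.
Require Import Defs.
From mathcomp Require Import all_boot all_order all_algebra.
From mathcomp Require Import finmap.
From mathcomp Require Import boolp classical_sets cardinality fsbigop.
From mathcomp.multinomials Require Import monalg.
From mathcomp Require Import ring.

Set Implicit Arguments.
Unset Strict Implicit.
Unset Printing Implicit Defensive.

Import Order.TTheory GRing.Theory Num.Theory.
Local Open Scope ring_scope.

(** * The Ringel form and the scalars *)

Section RingelForm.
Variable D : root_system.
Implicit Types (x y z : wvec D) (i j : 'I_(rk D)).

Lemma ringelDl x y z : ringel (x + y) z = ringel x z + ringel y z.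
Proof.
rewrite -big_split; apply: eq_bigr => i _; rewrite -big_split.
by apply: eq_bigr => j _; rewrite mxE !mulrDl.
Qed.

Lemma ringelDr x y z : ringel x (y + z) = ringel x y + ringel x z.
Proof.
rewrite -big_split; apply: eq_bigr => i _; rewrite -big_split.
by apply: eq_bigr => j _; rewrite mxE mulrDr mulrDl.
Qed.

Lemma ringelNl x y : ringel (- x) y = - ringel x y.
Proof.
rewrite -sumrN; apply: eq_bigr => i _; rewrite -sumrN.
by apply: eq_bigr => j _; rewrite mxE !mulNr.
Qed.

Lemma ringelNr x y : ringel x (- y) = - ringel x y.
Proof.
rewrite -sumrN; apply: eq_bigr => i _; rewrite -sumrN.
by apply: eq_bigr => j _; rewrite mxE mulrN mulNr.
Qed.

Lemma ringel0l x : ringel 0 x = 0.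
Proof. by apply: (addIr (ringel 0 x)); rewrite -ringelDl !add0r. Qed.

Lemma ringel0r x : ringel x 0 = 0.
Proof. by apply: (addIr (ringel x 0)); rewrite -ringelDr !add0r. Qed.

Lemma form_sumr x i : Defs.form x (alpha i) = \sum_j x 0 j * sform j i.
Proof.
apply: eq_bigr => j _; rewrite (big_only1 i) // => [|k ki _].
  by rewrite mxE !eqxx mulr1.
by rewrite mxE (negPf ki) andbF mulr0 mul0r.
Qed.

Lemma form_alpha i j : Defs.form (alpha i) (alpha j) = sform i j.
Proof.
rewrite form_sumr (big_only1 i) // => [|k ki _]; first by rewrite mxE !eqxx mul1r.
by rewrite mxE (negPf ki) andbF mul0r.
Qed.

Lemma half_sqlen_gt0 X k : (0 < half_sqlen X k)%N.
Proof. by case: X => [m|m|m|m|||||] //=; case: ifP. Qed.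

(** Within one type the half square lengths are [1] and at most one other value, so the larger of
    two is a multiple of each. Since adjacent simple roots pair to minus the larger one, this yields
    integral Cartan entries. *)
Lemma half_sqlen_dvd X k l :
  (half_sqlen X k %| maxn (half_sqlen X l) (half_sqlen X k))%N.
Proof. by case: X => [m|m|m|m|||||] //=; do 2!case: ifP. Qed.

Lemma cartan_int i j : 2 * sform j i / sform i i \is a Num.int.
Proof.
have dd0 : (dd i)%:R != 0 :> rat by rewrite pnatr_eq0 -lt0n half_sqlen_gt0.
rewrite {2}/sform eqxx natrM [2 * _]mulrC -mulf_div divff ?pnatr_eq0 // mulr1.
rewrite /sform; have [->|_] := eqVneq j i.
  by rewrite natrM mulrAC divff // mul1r rpred_nat.
case: ifP => _; last by rewrite mul0r.
have /dvdnP[k ->] := half_sqlen_dvd (rs_type D) (node i) (node j).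
by rewrite natrM mulNr mulfK // rpredN rpred_nat.
Qed.

(** [is_twist] and the weight scalings are controlled on weights in [P] only; this and the closure
    properties below keep the weights reached by words inside [P]. *)
Lemma wlattice_alpha i : wlattice (alpha i).
Proof. by move=> j; rewrite !form_alpha; apply: cartan_int. Qed.

Lemma wlatticeD x y : wlattice x -> wlattice y -> wlattice (x + y).
Proof.
move=> Px Py i; have -> : Defs.form (x + y) (alpha i) = Defs.form x (alpha i) + Defs.form y (alpha i).
  rewrite !form_sumr -big_split; apply: eq_bigr => j _.
  by rewrite mxE mulrDl.
by rewrite mulrDr mulrDl rpredD.
Qed.

Lemma wlatticeN x : wlattice x -> wlattice (- x).
Proof.
move=> Px i; have -> : Defs.form (- x) (alpha i) = - Defs.form x (alpha i).
  rewrite !form_sumr -sumrN; apply: eq_bigr => j _.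
  by rewrite mxE mulNr.
by rewrite mulrN mulNr rpredN.
Qed.

Definition wdeg (w : seq 'I_(rk D)) : wvec D := \sum_(i <- w) alpha i.

Lemma wdeg_cons i w : wdeg (i :: w) = alpha i + wdeg w.
Proof. exact: big_cons. Qed.

Lemma wdeg_nil : wdeg [::] = 0.
Proof. exact: big_nil. Qed.

Lemma wlattice_wdeg w : wlattice (wdeg w).
Proof.
elim: w => [|i w IHw]; last by rewrite wdeg_cons; apply/wlatticeD/IHw/wlattice_alpha.
by move=> i; rewrite wdeg_nil form_sumr big1 ?mulr0 ?mul0r // => j _; rewrite mxE mul0r.
Qed.

End RingelForm.

Section Powers.
Variables (K : fieldType) (D : root_system).
Implicit Types (e r s : rat -> K) (l m : wvec D).

(** Homomorphisms from the rationals to the units of [K], without a base point: [r], [s], [qpow] and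
    [qinvpow] all qualify, so each lemma below serves both quantum groups. *)
Definition power_morph e := {morph e : t u / t + u >-> t * u} /\ e 0 = 1.

Lemma power_morph_system x e : x != 0 -> power_system x e -> power_morph e.
Proof.
move=> x0 [eD e1]; split=> //.
by apply: (@mulfI _ (e 1)); rewrite ?mulr1 -?eD ?addr0 // e1.
Qed.

Lemma powerN e t : power_morph e -> e (- t) = (e t)^-1.
Proof.
case=> eD e0; apply: divr1_eq.
by rewrite invrK -eD addNr.
Qed.

Lemma power_neq0 e t : power_morph e -> e t != 0.
Proof.
case=> eD e0; apply: contraTneq (oner_neq0 K) => et0.
by rewrite -e0 -(subrr t) eD et0 mul0r eqxx.
Qed.

Variables (r s : rat -> K).
Hypotheses (rP : power_morph r) (sP : power_morph s).

Lemma qpow_morph : power_morph (qpow r s).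
Proof.
have [[rD r0] [sD s0]] := (rP, sP).
split=> [t u|]; last by rewrite /qpow mul0r oppr0 r0 s0 mulr1.
by rewrite /qpow mulrDl opprD rD sD; ring.
Qed.

Lemma qinvpow_morph : power_morph (qinvpow r s).
Proof.
have [qD q0] := qpow_morph.
by split=> [t u|]; rewrite /qinvpow ?oppr0 // opprD qD.
Qed.

Lemma ompairDl l l' m : ompair r s (l + l') m = ompair r s l m * ompair r s l' m.
Proof. by rewrite /ompair ringelDl ringelDr opprD rP.1 sP.1; ring. Qed.

Lemma ompairDr l m m' : ompair r s l (m + m') = ompair r s l m * ompair r s l m'.
Proof. by rewrite /ompair ringelDl ringelDr opprD rP.1 sP.1; ring. Qed.

Lemma ompairNl l m : ompair r s (- l) m = (ompair r s l m)^-1.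
Proof. by rewrite /ompair ringelNl ringelNr !powerN // invfM. Qed.

Lemma ompairNr l m : ompair r s l (- m) = (ompair r s l m)^-1.
Proof. by rewrite /ompair ringelNl ringelNr !powerN // invfM. Qed.

Lemma ompair0l m : ompair r s 0 m = 1.
Proof. by rewrite /ompair ringel0l ringel0r oppr0 rP.2 sP.2 mulr1. Qed.

Lemma ompair0r m : ompair r s m 0 = 1.
Proof. by rewrite /ompair ringel0l ringel0r oppr0 rP.2 sP.2 mulr1. Qed.

Lemma ompairV l m :
  (ompair r s l m)^-1 = r (- ringel l m) * s (ringel m l).
Proof. by rewrite /ompair invfM -!powerN // opprK. Qed.

Lemma ompair_neq0 l m : ompair r s l m != 0.
Proof. by rewrite mulf_neq0 ?power_neq0. Qed.

Lemma zetaDl l l' m : zeta r s (l + l') m = zeta r s l m * zeta r s l' m.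
Proof.
rewrite /zeta ringelDl ringelDr opprD addrACA mulrDl rP.1 sP.1; ring.
Qed.

Lemma zetaDr l m m' : zeta r s l (m + m') = zeta r s l m * zeta r s l m'.
Proof.
rewrite /zeta ringelDl ringelDr opprD addrACA mulrDl rP.1 sP.1; ring.
Qed.

Lemma zeta_alt l : zeta r s l l = 1.
Proof. by rewrite /zeta subrr mul0r rP.2 sP.2 mulr1. Qed.

Lemma zeta_neq0 l m : zeta r s l m != 0.
Proof. by rewrite mulf_neq0 ?power_neq0. Qed.

Lemma zeta0l m : zeta r s 0 m = 1.
Proof. by rewrite /zeta ringel0l ringel0r subrr mul0r rP.2 sP.2 mulr1. Qed.

Lemma zeta0r m : zeta r s m 0 = 1.
Proof. by rewrite /zeta ringel0l ringel0r subrr mul0r rP.2 sP.2 mulr1. Qed.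

Lemma zetaNr l m : zeta r s l (- m) = (zeta r s l m)^-1.
Proof.
apply: (mulIf (zeta_neq0 l m)).
by rewrite -zetaDr addNr zeta0r mulVf // zeta_neq0.
Qed.

(** Polarization of [zeta_alt] at [l + m]. *)
Lemma zeta_skew l m : zeta r s l m * zeta r s m l = 1.
Proof.
by have := zeta_alt (l + m); rewrite zetaDl !zetaDr !zeta_alt mulr1 mul1r.
Qed.

Lemma zetaC l m : zeta r s m l = (zeta r s l m)^-1.
Proof.
apply: (mulfI (zeta_neq0 l m)).
by rewrite zeta_skew mulfV // zeta_neq0.
Qed.

(** The exponents split into symmetric and antisymmetric parts of the Ringel form: the symmetric
    part gives the power of [q], the antisymmetric one gives [zeta ^- 2]. *)
Lemma ompair_twist l m :
  ompair r s l m = (zeta r s l m) ^- 2 * ompair (qpow r s) (qinvpow r s) l m.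
Proof.
rewrite /ompair /qinvpow /qpow /zeta !opprK.
set a := ringel l m; set b := ringel m l.
have [[rD _] [sD _]] := (rP, sP).
have pow2 e t : power_morph e -> (e t) ^- 2 = e (- (t + t)).
  by move=> eP; rewrite powerN // eP.1.
set c := (b - a) / 4; rewrite exprMn invfM !pow2 //.
have -> : r a = r (- (c + c)) * r (a / 2) * r (b / 2).
  by rewrite -!rP.1; congr r; rewrite /c; field.
have -> : s (- b) = s (- (c + c)) * s (- (a / 2)) * s (- (b / 2)).
  by rewrite -!sP.1; congr s; rewrite /c; field.
ring.
Qed.

End Powers.

(** * The Hopf pairing on words *)

Section WordPairing.
Variables (K : fieldType) (I : eqType).
Implicit Types (rho z : I -> I -> K) (kappa t h : I -> K) (F : seq I -> K).
Implicit Types (i j : I) (v w : seq I).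

(** A sum over the occurrences of [i] in [w]: [kappa i] times the factors
    [rho i l] of the letters [l] preceding the occurrence, times the value of [F]
    at [w] with this occurrence removed. *)
Fixpoint skew_deriv rho kappa i F w : K :=
  if w is j :: w' then
    (i == j)%:R * kappa i * F w' + rho i j * skew_deriv rho kappa i (F \o cons j) w'
  else 0.

(** The value of the Hopf pairing at the monomials [f_v] and [e_w]. *)
Fixpoint word_pairing rho kappa v w : K :=
  if v is i :: v' then skew_deriv rho kappa i (word_pairing rho kappa v') w
  else (w == [::])%:R.

Fixpoint cocycle z w : K :=
  if w is i :: w' then (\prod_(l <- w') z i l) * cocycle z w' else 1.

Lemma cocycle_neq0 z w : (forall i j, z i j != 0) -> cocycle z w != 0.
Proof.
move=> z0; elim: w => [|i w IHw] /=; first exact: oner_neq0.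
by rewrite mulf_neq0 // prodf_seq_neq0; apply/allP => l _; rewrite z0.
Qed.

Section Twist.
Variables (rho rho' z : I -> I -> K) (kappa kappa' t : I -> K).
Hypothesis z_neq0 : forall i j, z i j != 0.
Hypothesis z_alt : forall i, z i i = 1.
Hypothesis z_skew : forall i j, z i j * z j i = 1.
Hypothesis rho_twist : forall i j, rho i j = z i j ^- 2 * rho' i j.
Hypothesis kappa_twist : forall i, kappa i = t i * kappa' i.

(** Induction on [w] with [C] and [h] general: passing to [F \o cons j] turns [C] into [C * h j] and
    [h l] into [z j l * h l]. The new [h i] contributes [(z j i)^-1 = z i j], which cancels half of
    the [z i j ^- 2] coming from [rho]. *)
Lemma skew_deriv_twist i (C : K) h F F' w : (forall l, h l != 0) ->
  (forall x, F x = C * (cocycle z x * \prod_(l <- x) h l) * F' x) ->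
  skew_deriv rho kappa i F w =
  t i * C * (cocycle z w * \prod_(l <- w) h l) * (h i)^-1
    * (\prod_(l <- w) z i l)^-1 * skew_deriv rho' kappa' i F' w.
Proof.
elim: w C h F F' => [|j w IHw] C h F F' h0 FF' /=; first by rewrite mulr0.
have p0 g : (forall l, g l != 0) -> \prod_(l <- w) g l != 0 :> K.
  by move=> g0; rewrite prodf_seq_neq0; apply/allP => l _; rewrite g0.
rewrite (IHw (C * h j) (fun l => z j l * h l) _ (F' \o cons j)); last first.
- move=> x /=; rewrite FF' /= big_cons big_split /=; ring.
- by move=> l; rewrite mulf_neq0.
rewrite mulrDr FF' !big_cons rho_twist big_split /=; congr (_ + _).
  case: eqP => [<-|_]; last by rewrite !(mul0r, mulr0).
  by rewrite kappa_twist z_alt; field; rewrite (p0 _ (z_neq0 i)) h0.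
have -> : z j i = (z i j)^-1.
  by apply: (mulfI (z_neq0 i j)); rewrite z_skew divff.
by field; rewrite (p0 _ (z_neq0 i)) z_neq0 h0.
Qed.

(** Both words get their own scalar; the double product is a cross term, which becomes [1] once [v]
    and [w] have the same degree. *)
Lemma word_pairing_twist v w :
  word_pairing rho kappa v w =
  (\prod_(i <- v) t i) * (cocycle z v)^-1
    * (cocycle z w * \prod_(l <- w) \prod_(i <- v) (z i l)^-1)
    * word_pairing rho' kappa' v w.
Proof.
elim: v w => [|i v IHv] w.
  rewrite /= big_nil; case: w => [|j w]; last by rewrite mulr0.
  by rewrite big_nil /= invr1 !mulr1.
rewrite /= (@skew_deriv_twist _ ((\prod_(k <- v) t k) * (cocycle z v)^-1)
  (fun l => \prod_(k <- v) (z k l)^-1) _ (word_pairing rho' kappa' v)); first last.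
- exact: IHv.
- by move=> l; rewrite prodf_seq_neq0; apply/allP => k _; rewrite invr_neq0.
rewrite big_cons.
(* The factor [h i] is exactly what the new letter [i] adds to the cocycle of [v]. *)
have -> : (\prod_(k <- v) (z k i)^-1) = \prod_(l <- v) z i l.
  apply: eq_bigr => l _; apply: (mulIf (z_neq0 l i)).
  by rewrite z_skew mulVf.
have -> : \prod_(l <- w) \prod_(k <- i :: v) (z k l)^-1 =
    (\prod_(l <- w) z i l)^-1 * \prod_(l <- w) \prod_(k <- v) (z k l)^-1.
  by rewrite -prodfV -big_split; apply: eq_bigr => l _; rewrite big_cons.
rewrite invfM; ring.
Qed.

End Twist.
End WordPairing.

(** * Linear maps and tensor products *)

Section LinearMaps.
Variables (K : fieldType) (V W X : lmodType K) (f : V -> X).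
Hypothesis f_lin : linear f.

(** Module actions and [tlift B] are bare functions with linearity as a proposition; packing them
    gives access to the library lemmas. *)
Let linear_map : {linear V -> X} :=
  HB.pack f (GRing.isLinear.Build K V X *:%R f f_lin).

Lemma lin0 : f 0 = 0. Proof. exact: (raddf0 linear_map). Qed.

Lemma linD u v : f (u + v) = f u + f v.
Proof. exact: (raddfD linear_map). Qed.

Lemma linZ a u : f (a *: u) = a *: f u.
Proof. exact: (linearZ_LR linear_map). Qed.

Lemma lin_sum (I : Type) (e : seq I) (P : pred I) (F : I -> V) :
  f (\sum_(i <- e | P i) F i) = \sum_(i <- e | P i) f (F i).
Proof. exact: (raddf_sum linear_map). Qed.

End LinearMaps.

Section TensorProducts.
Variable K : fieldType.
Implicit Types V W X : lmodType K.

Lemma tens_bilinear V W : bilinear_map (@tens K V W).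
Proof.
split=> [w a v v'|v a w w']; rewrite /tens -linearP; apply/proj_quo_eq/span_gen.
  exact: tensor_rel_l.
exact: tensor_rel_r.
Qed.

Lemma tens_linl V W (w : W) : linear (fun v : V => tens v w).
Proof. exact: (tens_bilinear V W).1. Qed.

Lemma tens_linr V W (v : V) : linear (fun w : W => tens v w).
Proof. exact: (tens_bilinear V W).2. Qed.

Lemma tensor_spanned V W (t : tensor V W) :
  Defs.span [set u | exists v w, u = tens v w]%classic t.
Proof.
rewrite -[t]proj_quo_repr; set g := repr t.
rewrite [g]monalgE raddf_sum /=.
elim/big_rec: _ => [|p u _ Su]; first exact: Defs.span_nil.
have -> : mkmalgU p (mcoeff p g) =
    mcoeff p g *: (mkmalgU p 1 : malg (V * W)%type K).
  apply/malgP => k.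
  by rewrite mcoeffZ !mcoeffU mulrnAr mulr1.
rewrite linearZ /=; apply: Defs.span_cons => //.
by exists p.1, p.2; rewrite /tens -surjective_pairing.
Qed.

(** Span inductions on the tensor and on each factor in turn. With weight vectors as [S] and [T],
    identities between operators reduce to scalar identities. *)
Lemma tensor_linear_ext V W X (S : set V) (T : set W) (f g : tensor V W -> X) :
  linear f -> linear g -> (forall v, Defs.span S v) -> (forall w, Defs.span T w) ->
  (forall v w, S v -> T w -> f (tens v w) = g (tens v w)) -> f =1 g.
Proof.
move=> fl gl SV TW fg t.
elim: (tensor_spanned t) => [|a _ y [v [w ->]] _ IHy]; first by rewrite !lin0.
rewrite fl gl IHy; congr (a *: _ + _).
elim: (SV v) => [|b u u' Su _ IHu].
  by rewrite (lin0 (@tens_linl V W w)) !lin0.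
rewrite (@tens_linl V W w) fl gl IHu; congr (b *: _ + _).
elim: (TW w) => [|c x x' Tx _ IHx].
  by rewrite (lin0 (@tens_linr V W u)) !lin0.
by rewrite (@tens_linr V W u) fl gl IHx fg.
Qed.

(** [tlift] evaluates [B] on one fixed representative of [t], hence is linear in [B]. *)
Lemma tlift_comb V W X (B B1 B2 : V -> W -> X) a t :
  (forall v w, B v w = a *: B1 v w + B2 v w) ->
  tlift B t = a *: tlift B1 t + tlift B2 t.
Proof.
move=> BE; rewrite /tlift /free_lift scaler_sumr -big_split /=.
by apply: eq_bigr => p _; rewrite BE scalerDr !scalerA mulrC.
Qed.

Lemma flip_linear V W : linear (@flip K V W).
Proof.
apply: tlift_linear; split=> [w|v]; [exact: tens_linr|exact: tens_linl].
Qed.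

Lemma flipE V W (v : V) (w : W) : flip (tens v w) = tens w v.
Proof.
apply: tliftE; split=> [u|u]; [exact: tens_linr|exact: tens_linl].
Qed.

Lemma tmap_bilinear V W V' W' (f : V -> V') (g : W -> W') :
  linear f -> linear g -> bilinear_map (fun v w => tens (f v) (g w)).
Proof.
move=> fl gl; split=> [w a v v'|v a w w'].
  by rewrite fl; apply: (@tens_linl V' W' (g w)).
by rewrite gl; apply: (@tens_linr V' W' (f v)).
Qed.

Lemma tmap_linear V W V' W' (f : V -> V') (g : W -> W') :
  linear f -> linear g -> linear (tmap f g).
Proof. by move=> fl gl; apply/tlift_linear/tmap_bilinear. Qed.

Lemma tmapE V W V' W' (f : V -> V') (g : W -> W') v w :
  linear f -> linear g -> tmap f g (tens v w) = tens (f v) (g w).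
Proof.
by move=> fl gl; apply: (@tliftE K V W _ (fun v w => tens (f v) (g w)));
  apply: tmap_bilinear.
Qed.

End TensorProducts.

(** * Relations and Cartan elements of the quantum group *)

Section PresentedRelations.
Variables (K : fieldType) (D : root_system) (r s : rat -> K).
Variables (A : algType K) (g : gen (rk D) -> A).
Local Notation rel := (uq_rel r s g).
Local Notation pr := (palg_proj rel).

Lemma palg_proj_rel (a b : A) : rel a b -> pr a = pr b.
Proof.
move=> ab; apply/proj_quo_eq/span_gen.
by exists 1, 1, a, b; split=> //; rewrite mul1r mulr1.
Qed.

Lemma palg_proj_commute c (a b : A) : rel (a * b) (c *: (b * a)) ->
  palg_mul (pr a) (pr b) = c *: palg_mul (pr b) (pr a).
Proof. by move=> /palg_proj_rel ab; rewrite !palg_mulE ab -palg_prZ. Qed.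

End PresentedRelations.

Section QuantumGroupRelations.
Variables (K : fieldType) (D : root_system) (r s : rat -> K).
Local Notation n := (rk D).
Local Notation U := (Uq D r s).
Implicit Types i j : 'I_n.

Lemma uw_ue i j :
  uw r s false false i * ue r s j =
  (r (ringel (alpha j) (alpha i)) * s (- ringel (alpha i) (alpha j)))
    *: (ue r s j * uw r s false false i).
Proof. exact: (palg_proj_commute (rel_we r s (@fgen K (gen n)) i j)). Qed.

Lemma uw_uf i j :
  uw r s false false i * uf r s j =
  (r (- ringel (alpha j) (alpha i)) * s (ringel (alpha i) (alpha j)))
    *: (uf r s j * uw r s false false i).
Proof. exact: (palg_proj_commute (rel_wf r s (@fgen K (gen n)) i j)). Qed.

Lemma uw'_ue i j :
  uw r s true false i * ue r s j =
  (r (- ringel (alpha i) (alpha j)) * s (ringel (alpha j) (alpha i)))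
    *: (ue r s j * uw r s true false i).
Proof. exact: (palg_proj_commute (rel_w'e r s (@fgen K (gen n)) i j)). Qed.

Lemma uw'_uf i j :
  uw r s true false i * uf r s j =
  (r (ringel (alpha i) (alpha j)) * s (- ringel (alpha j) (alpha i)))
    *: (uf r s j * uw r s true false i).
Proof. exact: (palg_proj_commute (rel_w'f r s (@fgen K (gen n)) i j)). Qed.

(** The axiom [hp_ww] speaks of [uomega] only; evaluating it at this vector and at zero gives the
    pairings among the [omega_i], the [omega'_i] and [1]. *)
Definition uomega_vec i : qlat D := [ffun j => (j == i)%:Z].

Lemma qlvec_uomega_vec i : qlvec (uomega_vec i) = alpha i.
Proof.
apply/rowP => j; rewrite !mxE ffunE eqxx /=.
by case: (j == i).
Qed.

Lemma uomega_alpha p i : uomega r s p (uomega_vec i) = uw r s p false i.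
Proof.
rewrite /uomega (big_only1 i) // => [|j ji _]; first by rewrite ffunE eqxx.
by rewrite ffunE (negPf ji).
Qed.

Lemma uomega0 p : uomega r s p ([ffun=> 0] : qlat D) = 1.
Proof. by rewrite /uomega big1 // => i _; rewrite ffunE. Qed.

Lemma qlvec0 : qlvec ([ffun=> 0] : qlat D) = 0.
Proof. by apply/rowP => j; rewrite !mxE ffunE. Qed.

Lemma usub_uword (G : set (gen n)) (w : seq (gen n)) : (forall x, x \in w -> G x) -> usub G (uword r s w).
Proof. by move=> wG; apply: span_gen; exists w. Qed.

End QuantumGroupRelations.

(** * Coproducts of words and the recursion for the pairing *)

Section WordCoproduct.
Variables (K : fieldType) (n : nat) (U : algType K) (g : gen n -> U).
Implicit Types (i j : 'I_n) (v w : seq 'I_n) (x y : U).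
Local Notation word w := (\prod_(x <- w) g x).
Local Notation e i := (g (ge i)).
Local Notation f i := (g (gf i)).
Local Notation k i := (g (gw false false i)).
Local Notation k' i := (g (gw true false i)).

Definition eword w : U := word [seq ge i | i <- w].
Definition fword w : U := word [seq gf i | i <- w].

Lemma eword_cons j w : eword (j :: w) = e j * eword w.
Proof. by rewrite /eword big_cons. Qed.

Lemma fword_cons j w : fword (j :: w) = f j * fword w.
Proof. by rewrite /fword big_cons. Qed.

Let mul_linr y : linear (fun x => y * x).
Proof. by move=> a u v; rewrite mulrDr -scalerAr. Qed.

Let inner_bilinear x y := tmap_bilinear (mul_linr x) (mul_linr y).

(** [tmul] over an arbitrary algebra, convertible to it over the quantum group; [pair_l] and
    [pair_r] below relate to [tpair_l] and [tpair_r] in the same way. *)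
Definition tensor_mul (t u : tensor U U) : tensor U U :=
  tlift (fun a b => tlift (fun c d => tens (a * c) (b * d)) u) t.

Let outer_bilinear (t : tensor U U) : bilinear_map
  (fun a b => tlift (fun c d => tens (a * c) (b * d)) t : tensor U U).
Proof.
split=> [b c a a'|a c b b']; apply: tlift_comb => x y.
  by rewrite mulrDl -scalerAl (tens_linl (b * y)).
by rewrite mulrDl -scalerAl (tens_linr (a * x)).
Qed.

Lemma tensor_mul_tens a b c d :
  tensor_mul (tens a b) (tens c d) = tens (a * c) (b * d).
Proof. by rewrite /tensor_mul tliftE ?tliftE //; apply: inner_bilinear. Qed.

Lemma tensor_mul_linl (t : tensor U U) : linear (fun u => tensor_mul u t).
Proof. exact: tlift_linear. Qed.

Lemma tensor_mul_linr (t : tensor U U) : linear (tensor_mul t).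
Proof.
move=> a u u'; apply: tlift_comb => c d.
exact: (tlift_linear (inner_bilinear c d)).
Qed.

(** The terms of the coproduct of [e_w], each of which sends every letter [e_j]
    either to [e_j (x) 1] or to [omega_j (x) e_j]. *)
Fixpoint splits w : seq (seq (gen n) * seq 'I_n) :=
  if w is j :: w' then
    [seq (ge j :: p.1, p.2) | p <- splits w'] ++
    [seq (gw false false j :: p.1, j :: p.2) | p <- splits w']
  else [:: ([::], [::])].

Lemma mem_splits w p z : p \in splits w -> z \in p.1 ->
  exists j, z = ge j \/ z = gw false false j.
Proof.
elim: w p => [|j w IHw] p /=; first by rewrite inE => /eqP ->.
rewrite mem_cat => /orP[] /mapP[q qw ->] /=; rewrite inE => /predU1P[->|];
  by [apply: IHw|exists j; left|exists j; right].
Qed.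

Variable cop : U -> tensor U U.
Hypothesis cop1 : cop 1 = tens 1 1.
Hypothesis copM : forall x y, cop (x * y) = tensor_mul (cop x) (cop y).
Hypothesis cop_e : forall i, cop (e i) = tens (e i) 1 + tens (k i) (e i).
Hypothesis cop_f : forall i, cop (f i) = tens 1 (f i) + tens (f i) (k' i).

Lemma cop_eword w :
  cop (eword w) = \sum_(p <- splits w) tens (word p.1) (eword p.2).
Proof.
elim: w => [|j w IHw]; first by rewrite big_seq1 /eword !big_nil cop1.
rewrite eword_cons copM IHw cop_e (linD (tensor_mul_linl _)).
rewrite !(lin_sum (tensor_mul_linr _)) big_cat !big_map /=.
congr (_ + _); apply: eq_bigr => p _; rewrite tensor_mul_tens ?mul1r big_cons //.
by rewrite eword_cons.
Qed.

Variables (B : U -> U -> Kmod K) (Ule Uge : set U).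
Variables (rho : 'I_n -> 'I_n -> K) (kappa : 'I_n -> K).

Definition pair_l y y' : tensor U U -> Kmod K :=
  tlift (fun a b => (B y a * B y' b : Kmod K)).
Definition pair_r (t : tensor U U) x x' : Kmod K :=
  tlift (fun a b => (B a x * B b x' : Kmod K)) t.

Hypothesis B_bilinear : bilinear_map B.
Hypothesis Uge_word : forall w : seq (gen n),
  (forall z, z \in w -> exists j, z = ge j \/ z = gw false false j) ->
  Uge (word w).
Hypothesis Ule_word : forall w : seq (gen n),
  (forall z, z \in w -> exists j, z = gf j) -> Ule (word w).
Hypothesis B_mul_l : forall y y' x, Ule y -> Ule y' -> Uge x ->
  B (y * y') x = pair_l y y' (cop x).
Hypothesis B_mul_r : forall y x x', Ule y -> Uge x -> Uge x' ->
  B y (x * x') = pair_r (cop y) x' x.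
Hypothesis B_fk : forall i j, B (f i) (k j) = 0.
Hypothesis B_ke : forall i j, B (k' i) (e j) = 0.
Hypothesis B_fe : forall i j, B (f i) (e j) = (i == j)%:R * kappa i.
Hypothesis B_kk : forall i j, B (k' i) (k j) = rho i j.
Hypothesis B_1k : forall i, B 1 (k i) = 1.
Hypothesis B_k1 : forall i, B (k' i) 1 = 1.
Hypothesis B_11 : B 1 1 = 1.

Let pair_l_bilinear y y' : bilinear_map (fun a b => (B y a * B y' b : Kmod K)).
Proof.
have [_ B_lin] := B_bilinear.
split=> [b c a a'|a c b b']; rewrite B_lin.
  by rewrite mulrDl -scalerAl.
by rewrite mulrDr -scalerAr.
Qed.

Let pair_r_bilinear x x' : bilinear_map (fun a b => (B a x * B b x' : Kmod K)).
Proof.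
have [B_lin _] := B_bilinear.
split=> [b c a a'|a c b b']; rewrite B_lin.
  by rewrite mulrDl -scalerAl.
by rewrite mulrDr -scalerAr.
Qed.

Let pair_l_tens y y' a b : pair_l y y' (tens a b) = B y a * B y' b.
Proof. exact: (tliftE _ _ (pair_l_bilinear y y')). Qed.

Let pair_r_tens x x' a b : pair_r (tens a b) x x' = B a x * B b x'.
Proof. exact: (tliftE _ _ (pair_r_bilinear x x')). Qed.

Let pair_l_lin y y' : linear (pair_l y y').
Proof. exact: (tlift_linear (pair_l_bilinear y y')). Qed.

Let pair_r_lin x x' : linear (fun t => pair_r t x x').
Proof. exact: (tlift_linear (pair_r_bilinear x x')). Qed.

Let Uge_e j : Uge (e j).
Proof.
have -> : e j = word [:: ge j] by rewrite big_seq1.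
apply: Uge_word => z.
by rewrite inE => /eqP ->; exists j; left.
Qed.

Let Uge_k j : Uge (k j).
Proof.
have -> : k j = word [:: gw false false j] by rewrite big_seq1.
apply: Uge_word => z.
by rewrite inE => /eqP ->; exists j; right.
Qed.

Let Ule_f j : Ule (f j).
Proof.
have -> : f j = word [:: gf j] by rewrite big_seq1.
apply: Ule_word => z.
by rewrite inE => /eqP ->; exists j.
Qed.

Let Uge_eword w : Uge (eword w).
Proof. by apply: Uge_word => z /mapP[j _ ->]; exists j; left. Qed.

Let Ule_fword w : Ule (fword w).
Proof. by apply: Ule_word => z /mapP[j _ ->]; exists j. Qed.

Let Uge_splits w p : p \in splits w -> Uge (word p.1).
Proof. by move=> pw; apply: Uge_word => z; apply: mem_splits pw. Qed.

Let Uge1 : Uge 1.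
Proof. by have := Uge_eword [::]; rewrite /eword big_nil. Qed.

Let Ule1 : Ule 1.
Proof. by have := Ule_fword [::]; rewrite /fword big_nil. Qed.

(** The values [B 1 (e j)] and [B (f i) 1] are not among the axioms: expanding [1 = 1 * 1] expresses
    each as twice itself. *)
Let eq_double (a : K) : a = a + a -> a = 0.
Proof. by move/eqP; rewrite -subr_eq subrr eq_sym => /eqP. Qed.

Let B_1e j : B 1 (e j) = 0.
Proof.
apply: eq_double; have := B_mul_l Ule1 Ule1 (Uge_e j).
by rewrite mulr1 cop_e (linD (pair_l_lin 1 1)) !pair_l_tens B_11 B_1k mulr1 mul1r.
Qed.

Let B_1M x x' : Uge x -> Uge x' -> B 1 (x * x') = B 1 x' * B 1 x.
Proof. by move=> xg x'g; rewrite B_mul_r // cop1 pair_r_tens. Qed.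

Let B_fM i x x' : Uge x -> Uge x' ->
  B (f i) (x * x') = B 1 x' * B (f i) x + B (f i) x' * B (k' i) x.
Proof.
by move=> xg x'g; rewrite B_mul_r // cop_f (linD (pair_r_lin x' x)) !pair_r_tens.
Qed.

Let B_f1 i : B (f i) 1 = 0.
Proof.
apply: eq_double; have := B_fM i Uge1 Uge1.
by rewrite mulr1 B_11 B_k1 mul1r mulr1.
Qed.

(** Pairing with [1] kills every left factor containing some [e j]. The one surviving term sends all
    letters to [omega_j (x) e_j], and its right factor is the whole of [w]. *)
Lemma sum_splits_counit (F : seq 'I_n -> K) w :
  \sum_(p <- splits w) B 1 (word p.1) * F p.2 = F w.
Proof.
elim: w F => [|j w IHw] F; first by rewrite big_seq1 big_nil B_11 mul1r.
rewrite big_cat !big_map /= big1_seq ?add0r => [|p /andP[_ /Uge_splits pw]].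
  rewrite -[F _]/((F \o cons j) w) -(IHw (F \o cons j)) big_seq [RHS]big_seq.
  apply: eq_bigr => p /Uge_splits pw.
  by rewrite big_cons B_1M // B_1k mulr1.
by rewrite big_cons B_1M // B_1e mulr0 mul0r.
Qed.

(** [f_i] acts on the subalgebra generated by the [e_j] and [omega_j] as a skew
    derivation, relative to the characters given by [1] and [omega'_i]. *)
Lemma sum_splits_f i (F : seq 'I_n -> K) w :
  \sum_(p <- splits w) B (f i) (word p.1) * F p.2 = skew_deriv rho kappa i F w.
Proof.
elim: w F => [|j w IHw] F /=; first by rewrite big_seq1 big_nil B_f1 mul0r.
rewrite big_cat !big_map /=; congr (_ + _).
  (* The terms starting with [e j]: since [omega'_i] pairs to zero with [e j], the rest of the left
     factor is paired with [1], and the sum collapses to [F w]. *)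
  rewrite -[F w]sum_splits_counit mulr_sumr big_seq [RHS]big_seq.
  apply: eq_bigr => p /Uge_splits pw; rewrite big_cons B_fM // B_fe B_ke.
  by rewrite mulr0 addr0 [B 1 _ * (_ * _)]mulrC -!mulrA.
(* The terms starting with [omega_j]: [f i] moves on to the rest of the word at the cost of
   [rho i j]. *)
rewrite -(IHw (F \o cons j)) mulr_sumr big_seq [RHS]big_seq.
apply: eq_bigr => p /Uge_splits pw; rewrite big_cons B_fM // B_fk B_kk.
by rewrite mulr0 add0r mulrA [rho _ _ * _]mulrC.
Qed.

(** Multiplicativity on the left splits off the first letter [f i], which is paired with the left
    factors of the coproduct of [eword w], and the rest of [v] with the right factors. *)
Lemma pair_fword_eword v w :
  B (fword v) (eword w) = word_pairing rho kappa v w.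
Proof.
elim: v w => [|i v IHv] w /=.
  rewrite /fword big_nil; case: w => [|j w]; first by rewrite /eword big_nil B_11.
  by rewrite eword_cons B_1M // B_1e mulr0.
rewrite fword_cons B_mul_l // cop_eword (lin_sum (pair_l_lin _ _)).
rewrite -sum_splits_f; apply: eq_bigr => p _.
by rewrite pair_l_tens -IHv.
Qed.

End WordCoproduct.

Section HopfPairing.
Variables (K : fieldType) (D : root_system) (r s : rat -> K).
Hypotheses (rP : power_morph r) (sP : power_morph s).
Local Notation n := (rk D).
Local Notation U := (Uq D r s).
Implicit Types i j : 'I_n.
Implicit Types v w : seq 'I_n.
Variables (cop : U -> tensor U U) (B : U -> U -> Kmod K).
Hypotheses (copP : is_coproduct cop) (BP : is_hopf_pairing cop B).

Definition fe_scalar i : K := (si s i - ri r i)^-1.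
Definition alpha_pair i j : K := ompair r s (alpha i) (alpha j).

Lemma hopf_pair_words v w :
  B (fword (uq_gen r s) v) (eword (uq_gen r s) w) =
  word_pairing alpha_pair fe_scalar v w.
Proof.
refine (@pair_fword_eword K n U (uq_gen r s) cop (cop1 copP) (copM copP)
  (cop_e copP) (cop_f copP) B (usub (@gens_le D)) (usub (@gens_ge D))
  alpha_pair fe_scalar (hp_bilinear BP) _ _ (hp_mul_l BP) (hp_mul_r BP)
  (hp_fw BP) (hp_we BP) (hp_fe BP) _ _ _ _ v w).
- move=> a aP; apply: usub_uword => x /aP[j [->|->]]; [left|right].
    by exists j.
  by exists false, j.
- by move=> a aP; apply: usub_uword => x /aP[j ->]; left; exists j.
- move=> i j; have := hp_ww BP (uomega_vec i) (uomega_vec j).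
  by rewrite !uomega_alpha !qlvec_uomega_vec.
- move=> j; have := hp_ww BP [ffun=> 0] (uomega_vec j).
  by rewrite uomega_alpha uomega0 qlvec0 ompair0l.
- move=> j; have := hp_ww BP (uomega_vec j) [ffun=> 0].
  by rewrite uomega_alpha uomega0 qlvec0 ompair0r.
- have := hp_ww BP [ffun=> 0] [ffun=> 0].
  by rewrite !uomega0 qlvec0 ompair0l.
Qed.

End HopfPairing.

(** * Canonical elements of dual pairings *)

Section CanonicalElement.
Variable K : fieldType.

(** The sizes are equal only propositionally, being the dimensions recorded in two independent
    [hopf_data]. *)
Lemma mul1mx_swap m n (A : 'M[K]_(m, n)) (B : 'M[K]_(n, m)) :
  m = n -> A *m B = 1%:M -> B *m A = 1%:M.
Proof. by move=> mn; subst n; apply: mulmx1C. Qed.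

Lemma mul1mx_leq m n (A : 'M[K]_(m, n)) (B : 'M[K]_(n, m)) :
  A *m B = 1%:M -> (m <= n)%N.
Proof.
move=> AB; rewrite -(mxrank1 K m) -AB.
exact: leq_trans (mxrankM_maxl _ _) (rank_leq_col _).
Qed.

Section Pairings.
Variables (E1 F1 E2 F2 : lmodType K).
Variables (B1 : F1 -> E1 -> Kmod K) (B2 : F2 -> E2 -> Kmod K).
Hypothesis (B2_bilinear : bilinear_map B2).
Variables (RE : E1 -> E2 -> Prop) (RF : F1 -> F2 -> Prop).
Hypothesis pair_rel :
  forall x x' y y', RE x x' -> RF y y' -> B1 y x = B2 y' x'.
Variables (SE : set E2) (SF : set F2).
Variables (m n : nat).
Variables (x1 : 'I_m -> E1) (y1 : 'I_m -> F1) (x2 : 'I_n -> E2) (y2 : 'I_n -> F2).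
Hypothesis dual1 : forall i j, B1 (y1 i) (x1 j) = (i == j)%:R.
Hypothesis dual2 : forall i j, B2 (y2 i) (x2 j) = (i == j)%:R.
Hypothesis basis_x2 : is_basis SE x2.
Hypothesis basis_y2 : is_basis SF y2.
Hypothesis lift_x1 : forall i, exists2 x', SE x' & RE (x1 i) x'.
Hypothesis lift_y1 : forall i, exists2 y', SF y' & RF (y1 i) y'.

(** [A] and [B] hold the coordinates, in the second pair of bases, of elements related to the first
    pair. Preservation of the pairing turns duality of both pairs into the matrix identity. *)
Lemma dual_basis_lift : exists A B : 'M[K]_(m, n),
  [/\ forall i, RE (x1 i) (\sum_k A i k *: x2 k),
      forall i, RF (y1 i) (\sum_k B i k *: y2 k) & B *m A^T = 1%:M].
Proof.
have ex_A i : exists a : 'rV[K]_n, RE (x1 i) (\sum_k a 0 k *: x2 k).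
  have [x' Sx' Rx'] := lift_x1 i.
  by have [a [xE _]] := basis_x2.2 _ Sx'; exists a; rewrite -xE.
have ex_B i : exists b : 'rV[K]_n, RF (y1 i) (\sum_k b 0 k *: y2 k).
  have [y' Sy' Ry'] := lift_y1 i.
  by have [b [yE _]] := basis_y2.2 _ Sy'; exists b; rewrite -yE.
have [a aP] := choice ex_A; have [b bP] := choice ex_B.
exists (\matrix_(i, k) a i 0 k), (\matrix_(i, k) b i 0 k); split.
- by move=> i; under eq_bigr do rewrite mxE.
- by move=> i; under eq_bigr do rewrite mxE.
apply/matrixP => i j; rewrite !mxE -dual1 (pair_rel (aP j) (bP i)).
have [B2l B2r] := B2_bilinear.
rewrite (lin_sum (B2l _)); apply: eq_bigr => k _.
rewrite (linZ (B2l _)) (lin_sum (B2r _)) (big_only1 k) // => [|l lk _].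
  by rewrite (linZ (B2r _)) dual2 eqxx !mxE [_ *: 1]mulr1.
by rewrite (linZ (B2r _)) dual2 eq_sym (negPf lk) scaler0.
Qed.

Lemma dual_basis_leq : (m <= n)%N.
Proof. by have [A [B [_ _ /mul1mx_leq]]] := dual_basis_lift. Qed.

Variables (X : lmodType K) (T1 : F1 -> E1 -> X) (T2 : F2 -> E2 -> X) (c : K).
Hypothesis T2_bilinear : bilinear_map T2.
Hypothesis T_rel :
  forall x x' y y', RE x x' -> RF y y' -> T1 y x = c *: T2 y' x'.

(** The basis independence of a canonical element, along relations instead of isomorphisms. Equality
    of the dimensions lets the one-sided inverse [B *m A^T = 1] be reversed, and it is the reversed
    product that appears in the sum. *)
Lemma canonical_element_rel : m = n ->
  \sum_i T1 (y1 i) (x1 i) = c *: \sum_k T2 (y2 k) (x2 k).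
Proof.
move=> mn; have [A [B [xA yB BA]]] := dual_basis_lift.
have AB : A^T *m B = 1%:M := mul1mx_swap mn BA.
have [T2l T2r] := T2_bilinear.
under eq_bigr => i _ do rewrite (T_rel (xA i) (yB i)).
rewrite -scaler_sumr; congr (_ *: _).
transitivity (\sum_i \sum_k \sum_l (A i l * B i k) *: T2 (y2 k) (x2 l)).
  apply: eq_bigr => i _; rewrite (lin_sum (T2l _)); apply: eq_bigr => k _.
  rewrite (linZ (T2l _)) (lin_sum (T2r _)) scaler_sumr; apply: eq_bigr => l _.
  by rewrite (linZ (T2r _)) scalerA mulrC.
rewrite exchange_big; apply: eq_bigr => k _.
have ABE l : \sum_i A i l * B i k = (l == k)%:R.
  have /matrixP/(_ l k) := AB; rewrite !mxE => <-.
  by apply: eq_bigr => i _; rewrite mxE.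
rewrite exchange_big (big_only1 k) //= => [|l lk _].
  by rewrite -scaler_suml ABE eqxx scale1r.
by rewrite -scaler_suml ABE (negPf lk) scale0r.
Qed.

End Pairings.
End CanonicalElement.

(** * The twisted action *)

Section WeightSpaces.
Variables (K : fieldType) (D : root_system) (r s : rat -> K).
Hypotheses (rP : power_morph r) (sP : power_morph s).
Variables (V : lmodType K) (M : uq_module D r s V).
Implicit Types (i j : 'I_(rk D)) (l m : wvec D) (v : V) (w : seq 'I_(rk D)).

Lemma uact_commute (a b : Uq D r s) c v :
  a * b = c *: (b * a) -> uact M a (uact M b v) = c *: uact M b (uact M a v).
Proof.
by move=> ab; rewrite -!uactM ab (linZ (uact_linl M v)).
Qed.

Lemma wt_space_ue l v j :
  wt_space M l v -> wt_space M (l + alpha j) (uact M (ue r s j) v).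
Proof.
move=> vl i; have [vi v'i] := vl i; split.
  rewrite (uact_commute _ (uw_ue r s i j)) vi (linZ (uact_linr M _)) scalerA.
  by rewrite -/(ompair _ _ _ _) ompairDl // mulrC.
rewrite (uact_commute _ (uw'_ue r s i j)) v'i (linZ (uact_linr M _)) scalerA.
by rewrite -ompairV // -invfM -ompairDr // addrC.
Qed.

Lemma wt_space_uf l v j :
  wt_space M l v -> wt_space M (l - alpha j) (uact M (uf r s j) v).
Proof.
move=> vl i; have [vi v'i] := vl i; split.
  rewrite (uact_commute _ (uw_uf r s i j)) vi (linZ (uact_linr M _)) scalerA.
  by rewrite -ompairV // -ompairNl // -ompairDl // addrC.
rewrite (uact_commute _ (uw'_uf r s i j)) v'i (linZ (uact_linr M _)) scalerA.
by rewrite -/(ompair _ _ _ _) -[ompair _ _ _ (alpha j)]invrK -invfM -ompairNr // -ompairDr // addrC.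
Qed.

Lemma uact_eword_nil v : uact M (eword (uq_gen r s) [::]) v = v.
Proof.
by rewrite -[RHS](uact1 M); congr (uact M _ v); rewrite /eword big_nil.
Qed.

Lemma uact_fword_nil v : uact M (fword (uq_gen r s) [::]) v = v.
Proof.
by rewrite -[RHS](uact1 M); congr (uact M _ v); rewrite /fword big_nil.
Qed.

Lemma uact_eword_cons j w v : uact M (eword (uq_gen r s) (j :: w)) v =
  uact M (ue r s j) (uact M (eword (uq_gen r s) w) v).
Proof.
by rewrite -uactM; congr (uact M _ v); rewrite eword_cons.
Qed.

Lemma uact_fword_cons j w v : uact M (fword (uq_gen r s) (j :: w)) v =
  uact M (uf r s j) (uact M (fword (uq_gen r s) w) v).
Proof.
by rewrite -uactM; congr (uact M _ v); rewrite fword_cons.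
Qed.

Lemma wt_space_eword l v w :
  wt_space M l v -> wt_space M (l + wdeg w) (uact M (eword (uq_gen r s) w) v).
Proof.
move=> vl; elim: w => [|j w IHw]; first by rewrite uact_eword_nil wdeg_nil addr0.
by rewrite uact_eword_cons wdeg_cons addrCA addrC; apply: wt_space_ue.
Qed.

Lemma wt_space_fword l v w :
  wt_space M l v -> wt_space M (l - wdeg w) (uact M (fword (uq_gen r s) w) v).
Proof.
move=> vl; elim: w => [|j w IHw]; first by rewrite uact_fword_nil wdeg_nil subr0.
rewrite uact_fword_cons wdeg_cons opprD addrA addrAC.
exact: wt_space_uf.
Qed.

Lemma wt_space_linear l a u v :
  wt_space M l u -> wt_space M l v -> wt_space M l (a *: u + v).
Proof.
move=> ul vl i; have [[u1 u2] [v1 v2]] := (ul i, vl i); split.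
  by rewrite (uact_linr M) u1 v1 scalerDr !scalerA [a * _]mulrC.
by rewrite (uact_linr M) u2 v2 scalerDr !scalerA [a * _]mulrC.
Qed.

Lemma wt_space0 l : wt_space M l 0.
Proof. by move=> i; rewrite !(lin0 (uact_linr M _)) !scaler0. Qed.

Lemma wt_spaceZ l a v : wt_space M l v -> wt_space M l (a *: v).
Proof.
by move=> vl; rewrite -[a *: v]addr0; apply: wt_space_linear => //; apply: wt_space0.
Qed.

End WeightSpaces.

Section TwistedWords.
Variables (K : fieldType) (D : root_system) (r s : rat -> K).
Hypotheses (rP : power_morph r) (sP : power_morph s).
Variables (V : lmodType K) (M : uq_module D (qpow r s) (qinvpow r s) V).
Variables (N : uq_module D r s V).
Hypothesis N_twist : is_twist M N.
Local Notation z := (zeta r s).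
Local Notation za := (fun i j : 'I_(rk D) => z (alpha i) (alpha j)).
Implicit Types (i j : 'I_(rk D)) (l m : wvec D) (v : V) (w : seq 'I_(rk D)).

(** The factor [(r_i s_i)^(-1/2)] of the twisted action of [f_i]. *)
Definition f_twist i : K := r (- (dd i)%:R / 2) * s (- (dd i)%:R / 2).

Lemma zeta_wdegr l w : \prod_(j <- w) z l (alpha j) = z l (wdeg w).
Proof.
elim: w => [|j w IHw]; first by rewrite big_nil wdeg_nil zeta0r.
by rewrite big_cons IHw wdeg_cons zetaDr.
Qed.

Lemma zeta_wdegl l w : \prod_(j <- w) z (alpha j) l = z (wdeg w) l.
Proof.
elim: w => [|j w IHw]; first by rewrite big_nil wdeg_nil zeta0l.
by rewrite big_cons IHw wdeg_cons zetaDl.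
Qed.

Let qP := qpow_morph rP sP.
Let qP' := qinvpow_morph rP sP.

(** The first letter [j] acts last, on a vector of weight [l + wdeg w], and contributes [zeta] of
    [alpha j] with this weight: the part at [l] enters [z (wdeg w) l], the part at [wdeg w] enters
    the cocycle. For the [f_i] the weight is [l - wdeg w], whence the inverse cocycle. *)
Lemma twist_eword l v w : wlattice l -> wt_space M l v ->
  uact N (eword (uq_gen r s) w) v =
  (z (wdeg w) l * cocycle za w) *: uact M (eword (uq_gen _ _) w) v.
Proof.
move=> Pl vl; elim: w => [|j w IHw].
  by rewrite !uact_eword_nil wdeg_nil zeta0l // mulr1 scale1r.
rewrite !uact_eword_cons IHw (linZ (uact_linr N _)).
have wl := wt_space_eword qP qP' w vl.
have [-> _ _ _] := N_twist j (wlatticeD Pl (wlattice_wdeg w)) wl.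
rewrite scalerA; congr (_ *: _).
by rewrite wdeg_cons zetaDl // zetaDr //= zeta_wdegr; ring.
Qed.

Lemma twist_fword l v w : wlattice l -> wt_space M l v ->
  uact N (fword (uq_gen r s) w) v =
  (z (wdeg w) l * ((\prod_(i <- w) f_twist i) * (cocycle za w)^-1))
    *: uact M (fword (uq_gen _ _) w) v.
Proof.
move=> Pl vl; elim: w => [|j w IHw].
  by rewrite !uact_fword_nil wdeg_nil zeta0l // big_nil invr1 !mulr1 scale1r.
rewrite !uact_fword_cons IHw (linZ (uact_linr N _)).
have wl := wt_space_fword qP qP' w vl.
have Plw := wlatticeD Pl (wlatticeN (wlattice_wdeg w)).
have [_ -> _ _] := N_twist j Plw wl.
rewrite scalerA; congr (_ *: _).
rewrite wdeg_cons zetaDl // zetaDr // zetaNr // big_cons /= zeta_wdegr.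
rewrite [(_ * cocycle _ _)^-1]invfM.
by rewrite /f_twist; ring.
Qed.

End TwistedWords.

(** * Rescaling of words as a correspondence *)

Section SpanPairs.
Variable K : fieldType.

Variables (I : Type) (P : set I) (E1 E2 : lmodType K).
Variables (g1 : I -> E1) (g2 : I -> E2) (a : I -> K).

Definition gen_span (E : lmodType K) (g : I -> E) : set E :=
  Defs.span [set u | exists2 w, P w & u = g w]%classic.

(** The span of the pairs of corresponding words. It is a relation because words satisfy linear
    relations, so that a map prescribed on words would first have to be shown well defined. *)
Definition pair_span : E1 -> E2 -> Prop := fun x x' =>
  gen_span (fun w => (g1 w, a w *: g2 w)) (x, x').

Lemma pair_span_liftr x : gen_span g1 x ->
  exists2 x', gen_span g2 x' & pair_span x x'.
Proof.
elim=> [|c _ y [w Pw ->] _ [y' Sy' Ry']]; first by exists 0; left.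
exists (c *: (a w *: g2 w) + y').
  by rewrite scalerA; right => //; exists w.
rewrite /pair_span.
have -> : (c *: g1 w + y, c *: (a w *: g2 w) + y') =
  c *: (g1 w, a w *: g2 w) + (y, y') by [].
by right => //; exists w.
Qed.

Lemma pair_span_liftl x' : (forall w, a w != 0) -> gen_span g2 x' ->
  exists2 x, gen_span g1 x & pair_span x x'.
Proof.
move=> a0; elim=> [|c _ y' [w Pw ->] _ [y Sy Ry]]; first by exists 0; left.
exists ((c / a w) *: g1 w + y); first by right => //; exists w.
rewrite /pair_span.
have -> : ((c / a w) *: g1 w + y, c *: g2 w + y') =
    (c / a w) *: (g1 w, a w *: g2 w) + (y, y').
  by congr (_, _); rewrite /= scalerA divfK.
by right => //; exists w.
Qed.

End SpanPairs.

(** The defect [T] is bilinear in the pairs [(y, y')] and [(x, x')], and vanishes on the pairs of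
    words that span both relations. *)
Lemma pair_span_bilinear (K : fieldType) (I : Type) (P : set I)
    (E1 E2 F1 F2 X : lmodType K) (e1 : I -> E1) (e2 : I -> E2) (a : I -> K)
    (f1 : I -> F1) (f2 : I -> F2) (b : I -> K)
    (T1 : F1 -> E1 -> X) (T2 : F2 -> E2 -> X) (c : K) x x' y y' :
  bilinear_map T1 -> bilinear_map T2 ->
  (forall v w, P v -> P w ->
     T1 (f1 v) (e1 w) = c *: T2 (b v *: f2 v) (a w *: e2 w)) ->
  pair_span P e1 e2 a x x' -> pair_span P f1 f2 b y y' ->
  T1 y x = c *: T2 y' x'.
Proof.
move=> [T1l T1r] [T2l T2r] T12 Rx Ry.
pose T (q : F1 * F2) (p : E1 * E2) := T1 q.1 p.1 - c *: T2 q.2 p.2.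
suff : T (y, y') (x, x') = 0 by move/eqP; rewrite subr_eq0 => /eqP.
elim: Rx => [|d _ p [w Pw ->] _ IHp].
  by rewrite /T /= (lin0 (T1r _)) (lin0 (T2r _)) scaler0 subr0.
have -> : T (y, y') (d *: (e1 w, a w *: e2 w) + p) =
    d *: T (y, y') (e1 w, a w *: e2 w) + T (y, y') p.
  rewrite /T /= T1r T2r scalerBr scalerDr opprD !scalerA [d * c]mulrC.
  by rewrite addrACA.
rewrite IHp addr0 {p IHp}.
elim: Ry => [|d' _ q [v Pv ->] _ IHq].
  by rewrite /T /= (lin0 (T1l _)) (lin0 (T2l _)) scaler0 subr0 scaler0.
have -> : T (d' *: (f1 v, b v *: f2 v) + q) (e1 w, a w *: e2 w) =
    d' *: T (f1 v, b v *: f2 v) (e1 w, a w *: e2 w) + T q (e1 w, a w *: e2 w).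
  rewrite /T /= T1l T2l scalerBr scalerDr opprD !scalerA [d' * c]mulrC.
  by rewrite addrACA.
by rewrite scalerDr IHq addr0 {1}/T /= T12 // subrr !scaler0.
Qed.

Section QuasiR.
Variables (K : fieldType) (D : root_system) (r s : rat -> K).
Local Notation n := (rk D).
Local Notation U := (Uq D r s).
Local Notation eword := (eword (uq_gen r s : gen n -> U)).
Local Notation fword := (fword (uq_gen r s : gen n -> U)).
Implicit Types (b : qplus D).

Definition deg_words b : set (seq 'I_n) := [set w | wdeg w = qvec b]%classic.

(** A word all of whose letters are some [ge i] comes from a word of indices of the same degree; for
    the [gf i] below the degree changes sign. *)
Lemma usub_deg_e b x :
  usub_deg (@gens_e D) (qvec b) x <-> gen_span (deg_words b) eword x.
Proof.
suff -> : usub_deg (@gens_e D) (qvec b) =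
    gen_span (deg_words b) eword :> set U by [].
congr (Defs.span _); apply/seteqP; split=> u /=.
  move=> [w [wP wb ->]].
  have [v wv] : exists v, w = [seq ge i | i <- v].
    elim: w wP {wb} => [|y w IHw] wP; first by exists [::].
    have [i ->] := wP y (mem_head _ _).
    by have [|v ->] := IHw; [move=> k kw; apply: wP; rewrite inE kw orbT|exists (i :: v)].
  by exists v; rewrite ?wv // /deg_words /= -wb wv big_map.
move=> [w wb ->]; exists [seq ge i | i <- w]; split=> //.
  by move=> y /mapP[i _ ->]; exists i.
by rewrite big_map.
Qed.

Lemma usub_deg_f b x :
  usub_deg (@gens_f D) (- qvec b) x <-> gen_span (deg_words b) fword x.
Proof.
suff -> : usub_deg (@gens_f D) (- qvec b) =
    gen_span (deg_words b) fword :> set U by [].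
congr (Defs.span _); apply/seteqP; split=> u /=.
  move=> [w [wP wb ->]].
  have [v wv] : exists v, w = [seq gf i | i <- v].
    elim: w wP {wb} => [|y w IHw] wP; first by exists [::].
    have [i ->] := wP y (mem_head _ _).
    by have [|v ->] := IHw; [move=> k kw; apply: wP; rewrite inE kw orbT|exists (i :: v)].
  exists v; rewrite ?wv //; apply: oppr_inj.
  by rewrite -wb wv big_map sumrN.
move=> [w wb ->]; exists [seq gf i | i <- w]; split=> //.
  by move=> y /mapP[i _ ->]; exists i.
by rewrite big_map sumrN -wb.
Qed.

End QuasiR.

(** * Comparison of the canonical elements *)

Section ThetaTwist.
Variables (K : fieldType) (D : root_system) (r s : rat -> K).
Hypotheses (rP : power_morph r) (sP : power_morph s).
Local Notation n := (rk D).
Local Notation q := (qpow r s).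
Local Notation q' := (qinvpow r s).
Local Notation U1 := (Uq D r s).
Local Notation U2 := (Uq D q q').
Variables (H1 : hopf_data D r s) (H2 : hopf_data D q q').
Local Notation z := (zeta r s).
Local Notation za := (fun i j : 'I_n => z (alpha i) (alpha j)).
Local Notation ew1 := (eword (uq_gen r s : gen n -> U1)).
Local Notation ew2 := (eword (uq_gen q q' : gen n -> U2)).
Local Notation fw1 := (fword (uq_gen r s : gen n -> U1)).
Local Notation fw2 := (fword (uq_gen q q' : gen n -> U2)).
Implicit Types (b : qplus D) (v w : seq 'I_n) (i j : 'I_n).

Let qP := qpow_morph rP sP.
Let qP' := qinvpow_morph rP sP.

Definition f_coef w : K := (\prod_(i <- w) f_twist r s i) * (cocycle za w)^-1.

(** With [u = r^(d/2)] and [v = s^(d/2)], this is [v^2 - u^2 = u v (v/u - u/v)], and it accounts for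
    the factor [(r_i s_i)^(-1/2)] in the twist. *)
Lemma fe_scalar_twist i : fe_scalar r s i = f_twist r s i * fe_scalar q q' i.
Proof.
rewrite /fe_scalar /ri /si /f_twist /qinvpow /qpow; set d := (dd i)%:R.
rewrite mulNr opprK !powerN //.
have -> : r d = r (d / 2) * r (d / 2) by rewrite -rP.1; congr r; field.
have -> : s d = s (d / 2) * s (d / 2) by rewrite -sP.1; congr s; field.
rewrite -!invfM; congr (_ ^-1); field.
by rewrite !power_neq0.
Qed.

Lemma cocycle_za_neq0 w : cocycle za w != 0.
Proof. by apply: cocycle_neq0 => i j; apply: zeta_neq0. Qed.

Lemma f_coef_neq0 w : f_coef w != 0.
Proof.
rewrite mulf_neq0 ?invr_neq0 ?cocycle_za_neq0 // prodf_seq_neq0.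
by apply/allP => i _; rewrite mulf_neq0 ?power_neq0.
Qed.

Lemma hd_pair_words_twist b v w : wdeg v = qvec b -> wdeg w = qvec b ->
  hd_pair H1 (fw1 v) (ew1 w) =
  hd_pair H2 (f_coef v *: fw2 v) (cocycle za w *: ew2 w).
Proof.
move=> vb wb.
have [Bl Br] := hp_bilinear (hd_pairP H2).
rewrite (linZ (Bl _)) (linZ (Br _)).
rewrite (hopf_pair_words rP sP (hd_copP H1) (hd_pairP H1)).
rewrite (hopf_pair_words qP qP' (hd_copP H2) (hd_pairP H2)).
rewrite (@word_pairing_twist _ _ _ (alpha_pair q q') za _ (fe_scalar q q')
  (f_twist r s)) => [||i|i j|i j|i]; first last.
- exact: fe_scalar_twist.
- exact: ompair_twist.
- exact: zeta_skew.
- exact: zeta_alt.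
- by move=> i j; apply: zeta_neq0.
(* The cross term is the inverse of [zeta] at [(qvec b, qvec b)], which is [1] as [zeta] is
   alternating. *)
have -> : \prod_(l <- w) \prod_(i <- v) (z (alpha i) (alpha l))^-1 = 1.
  transitivity ((\prod_(l <- w) z (wdeg v) (alpha l))^-1).
    by rewrite -prodfV; apply: eq_bigr => l _; rewrite prodfV zeta_wdegl.
  by rewrite zeta_wdegr // vb wb zeta_alt // invr1.
by rewrite mulr1 -/(f_coef v) -mulrA.
Qed.

Variable b : qplus D.
Local Notation RE := (pair_span (deg_words b) ew1 ew2 (cocycle za)).
Local Notation RF := (pair_span (deg_words b) fw1 fw2 f_coef).

Lemma hd_pair_twist x x' y y' : RE x x' -> RF y y' ->
  hd_pair H1 y x = hd_pair H2 y' x'.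
Proof.
move=> Rx Ry; rewrite -[RHS]scale1r.
apply: pair_span_bilinear (hp_bilinear (hd_pairP H1))
  (hp_bilinear (hd_pairP H2)) _ Rx Ry => v w vb wb.
by rewrite scale1r; apply: hd_pair_words_twist vb wb.
Qed.

Let lift_x1 k : exists2 x', usub_deg (@gens_e D) (qvec b) x' & RE (@hd_x _ _ _ _ H1 b k) x'.
Proof.
have /usub_deg_e xk := (hd_xP H1 b).1 k.
have [x' Sx' Rx'] := pair_span_liftr ew2 (cocycle za) xk.
by exists x' => //; apply/usub_deg_e.
Qed.

Let lift_y1 k : exists2 y', usub_deg (@gens_f D) (- qvec b) y' & RF (@hd_y _ _ _ _ H1 b k) y'.
Proof.
have /usub_deg_f yk := (hd_yP H1 b).1 k.
have [y' Sy' Ry'] := pair_span_liftr fw2 f_coef yk.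
by exists y' => //; apply/usub_deg_f.
Qed.

Let lift_x2 k : exists2 x, usub_deg (@gens_e D) (qvec b) x & RE x (@hd_x _ _ _ _ H2 b k).
Proof.
have /usub_deg_e xk := (hd_xP H2 b).1 k.
have [x Sx Rx] := pair_span_liftl ew1 cocycle_za_neq0 xk.
by exists x => //; apply/usub_deg_e.
Qed.

Let lift_y2 k : exists2 y, usub_deg (@gens_f D) (- qvec b) y & RF y (@hd_y _ _ _ _ H2 b k).
Proof.
have /usub_deg_f yk := (hd_yP H2 b).1 k.
have [y Sy Ry] := pair_span_liftl fw1 f_coef_neq0 yk.
by exists y => //; apply/usub_deg_f.
Qed.

(** [dual_basis_leq] is applied to the correspondence and to its converse; lifting in the second
    direction uses that the scalars attached to words are nonzero. *)
Lemma hd_dim_twist : hd_dim H1 b = hd_dim H2 b.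
Proof.
apply/eqP; rewrite eqn_leq; apply/andP; split.
  exact: (dual_basis_leq (hp_bilinear (hd_pairP H2)) hd_pair_twist (@hd_dual _ _ _ _ H1 b)
    (@hd_dual _ _ _ _ H2 b) (hd_xP H2 b) (hd_yP H2 b) lift_x1 lift_y1).
apply: (@dual_basis_leq K _ _ _ _ (hd_pair H2) (hd_pair H1)
    (hp_bilinear (hd_pairP H1)) (fun x' x => RE x x') (fun y' y => RF y y') _ _ _ _ _
    _ _ _ _ (@hd_dual _ _ _ _ H2 b) (@hd_dual _ _ _ _ H1 b) (hd_xP H1 b) (hd_yP H1 b) lift_x2 lift_y2).
by move=> x' x y' y Rx Ry; rewrite (hd_pair_twist Rx Ry).
Qed.

Variables (V W : lmodType K).
Variables (M : uq_module D q q' V) (N : uq_module D q q' W).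
Variables (M1 : uq_module D r s V) (N1 : uq_module D r s W).
Hypotheses (M1_twist : is_twist M M1) (N1_twist : is_twist N N1).

Lemma uact_tens_bilinear (r' s' : rat -> K) (A : uq_module D r' s' V)
    (B : uq_module D r' s' W) (v : V) (w : W) :
  bilinear_map (fun y x => tens (uact A y v) (uact B x w)).
Proof.
split=> [x a y y'|y a x x'].
  by rewrite (uact_linl A) (tens_linl (uact B x w)).
by rewrite (uact_linl B) (tens_linr (uact A y v)).
Qed.

(** The scalars of the individual words are absorbed by the two relations; only the factors
    [zeta (qvec b)] at the weights of [v] and [w] remain, and these are common to all words of
    degree [b]. *)
Lemma quasi_R_twist (l m : wvec D) (v : V) (w : W) : wlattice l -> wlattice m ->
  wt_space M l v -> wt_space N m w ->
  \sum_k tens (uact M1 (@hd_y _ _ _ _ H1 b k) v) (uact N1 (@hd_x _ _ _ _ H1 b k) w) =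
  (z (qvec b) l * z (qvec b) m) *:
    \sum_k tens (uact M (@hd_y _ _ _ _ H2 b k) v) (uact N (@hd_x _ _ _ _ H2 b k) w).
Proof.
move=> Pl Pm vl wm.
apply: (@canonical_element_rel K U1 U1 U2 U2 (hd_pair H1) (hd_pair H2)
    (hp_bilinear (hd_pairP H2)) RE RF hd_pair_twist _ _ _ _ _ _ _ _
    (@hd_dual _ _ _ _ H1 b) (@hd_dual _ _ _ _ H2 b) (hd_xP H2 b) (hd_yP H2 b) lift_x1 lift_y1
    _ (fun y x => tens (uact M1 y v) (uact N1 x w))
    (fun y x => tens (uact M y v) (uact N x w)) _
    (uact_tens_bilinear M N v w) _ hd_dim_twist).
move=> x x' y y' Rx Ry.
apply: pair_span_bilinear (uact_tens_bilinear M1 N1 v w)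
  (uact_tens_bilinear M N v w) _ Rx Ry => f e fb eb.
rewrite (twist_fword rP sP M1_twist _ Pl vl) (twist_eword rP sP N1_twist _ Pm wm).
rewrite (linZ (uact_linl M _)) (linZ (uact_linl N _)).
rewrite !(linZ (tens_linl _)) !(linZ (tens_linr _)) !scalerA; congr (_ *: _).
by rewrite fb eb -/(f_coef f) /=; ring.
Qed.

End ThetaTwist.

(** * Weight components *)

Section WeightComponents.
Variables (K : fieldType) (D : root_system) (r s : rat -> K).
Variables (V : lmodType K) (M : uq_module D r s V).
Hypothesis M_dec : forall v, exists! c, wt_decomposition M v c.
Implicit Types (l m : wvec D) (v : V) (c : wvec D -> V).

Lemma fsbig_wlattice (X : zmodType) (F : wvec D -> X) (A : {fset wvec D}) :
  (forall l, l \notin A -> F l = 0) -> (forall l, ~ wlattice l -> F l = 0) ->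
  \sum_(l \in @wlattice D) F l = \sum_(l <- A) F l.
Proof.
move=> FA FP; rewrite -(@fsbigTE _ _ _ _ A F FA); apply: fsbig_widen => // l [_ nPl] /=.
exact: FP.
Qed.

Lemma wt_decomposition_sum v c (A : {fset wvec D}) : wt_decomposition M v c ->
  (forall l, l \notin A -> c l = 0) -> v = \sum_(l <- A) c l.
Proof. by move=> [_ _ cP vE] cA; rewrite {1}vE (fsbig_wlattice cA cP). Qed.

Lemma wt_decomposition_supp v c : wt_decomposition M v c ->
  exists A : {fset wvec D}, forall l, l \notin A -> c l = 0.
Proof.
move=> [/finite_fsetP[A AE] _ _ _]; exists A => l lA; apply/eqP.
by apply: contraNT lA => cl; have : [set` A]%classic l by rewrite -AE.
Qed.

Lemma wt_decomposition_intro v c (A : {fset wvec D}) :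
  (forall l, l \notin A -> c l = 0) -> (forall l, wlattice l -> wt_space M l (c l)) ->
  (forall l, ~ wlattice l -> c l = 0) -> v = \sum_(l <- A) c l ->
  wt_decomposition M v c.
Proof.
move=> cA cM cP vE; split=> //; last by rewrite (fsbig_wlattice cA cP).
apply: sub_finite_set (finite_fset A) => l /= cl.
by apply: contraNT cl => /cA ->.
Qed.

Lemma wt_comp_decomposition v : wt_decomposition M v (wt_comp M ^~ v).
Proof.
have [c [vc c_uniq]] := M_dec v.
suff -> : wt_comp M ^~ v = c by [].
apply/funext => l; rewrite /wt_comp; case: xgetP => [x _ [c' /c_uniq -> ->]//|].
by move=> /(_ (c l))[]; exists c.
Qed.

Lemma wt_comp_eq v c l : wt_decomposition M v c -> wt_comp M l v = c l.
Proof.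
move=> vc; have [c' [_ c_uniq]] := M_dec v.
by rewrite -(c_uniq _ vc) (c_uniq _ (wt_comp_decomposition v)).
Qed.

Lemma wt_comp_supp v :
  exists A : {fset wvec D}, forall l, l \notin A -> wt_comp M l v = 0.
Proof. exact: wt_decomposition_supp (wt_comp_decomposition v). Qed.

Lemma wt_comp_outside v l : ~ wlattice l -> wt_comp M l v = 0.
Proof. by have [_ _ + _] := wt_comp_decomposition v; apply. Qed.

Lemma wt_comp_wt v l : wlattice l -> wt_space M l (wt_comp M l v).
Proof. by have [_ + _ _] := wt_comp_decomposition v; apply. Qed.

(** By uniqueness, since a linear combination of decompositions is a decomposition. *)
Lemma wt_comp_linear l : linear (wt_comp M l).
Proof.
move=> a u v; have [[A uA] [B vB]] := (wt_comp_supp u, wt_comp_supp v).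
pose c m := a *: wt_comp M m u + wt_comp M m v.
apply: (@wt_comp_eq _ c); apply: (@wt_decomposition_intro _ c (A `|` B)%fset).
- move=> m; rewrite in_fsetU negb_or => /andP[/uA um /vB vm].
  by rewrite /c um vm scaler0 addr0.
- by move=> m Pm; apply: wt_space_linear; apply: wt_comp_wt.
- by move=> m Pm; rewrite /c !wt_comp_outside // scaler0 addr0.
rewrite /c big_split -scaler_sumr /=.
rewrite -(wt_decomposition_sum (wt_comp_decomposition u)) => [|m]; last first.
  by rewrite in_fsetU negb_or => /andP[/uA].
rewrite -(wt_decomposition_sum (wt_comp_decomposition v)) // => m.
by rewrite in_fsetU negb_or => /andP[_ /vB].
Qed.

Lemma wt_compE l m v : wlattice l -> wt_space M l v ->
  wt_comp M m v = if m == l then v else 0.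
Proof.
move=> Pl vl; pose c m := if m == l then v else 0.
apply: (@wt_comp_eq _ c); apply: (@wt_decomposition_intro _ c [fset l]%fset).
- by move=> k; rewrite in_fset1 /c => /negPf ->.
- by move=> k Pk; rewrite /c; case: eqP => [->//|_]; apply: wt_space0.
- by move=> k; rewrite /c; case: eqP => [-> /(_ Pl)|].
- by rewrite big_seq_fset1 /c eqxx.
Qed.

Definition wt_vectors : set V :=
  [set v | exists2 l, wlattice l & wt_space M l v]%classic.

Lemma wt_vectors_span v : Defs.span wt_vectors v.
Proof.
have [A vA] := wt_comp_supp v.
rewrite (wt_decomposition_sum (wt_comp_decomposition v) vA).
elim/big_rec: _ => [|l x _ Sx]; first by left.
have [Pl|nPl] := pselect (wlattice l); last by rewrite wt_comp_outside // add0r.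
rewrite -[wt_comp M l v]scale1r; right=> //.
by exists l => //; apply: wt_comp_wt.
Qed.

End WeightComponents.

(** * Operators acting by scalars on weight spaces *)

Section WeightScaling.
Variables (K : fieldType) (D : root_system) (r s : rat -> K).
Variables (V W : lmodType K) (M : uq_module D r s V) (N : uq_module D r s W).
Hypothesis M_dec : forall v, exists! c, wt_decomposition M v c.
Hypothesis N_dec : forall v, exists! c, wt_decomposition N v c.
Implicit Types (c : wvec D -> wvec D -> K) (A B : {fset wvec D}).

Definition wt_scale_pair c v w : tensor V W :=
  \sum_(l \in @wlattice D) \sum_(m \in @wlattice D)
     c l m *: tens (wt_comp M l v) (wt_comp N m w).

(** [A] and [B] may be any finite sets containing the supports, so several vectors can share the
    same index sets, as bilinearity requires. *)
Lemma wt_scale_pairE c A B v w : (forall l, l \notin A -> wt_comp M l v = 0) ->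
  (forall l, l \notin B -> wt_comp N l w = 0) ->
  wt_scale_pair c v w =
  \sum_(l <- A) \sum_(m <- B) c l m *: tens (wt_comp M l v) (wt_comp N m w).
Proof.
move=> vA wB; have inner l : \sum_(m \in @wlattice D)
     c l m *: tens (wt_comp M l v) (wt_comp N m w) =
   \sum_(m <- B) c l m *: tens (wt_comp M l v) (wt_comp N m w).
  apply: fsbig_wlattice => m => [/wB|/(wt_comp_outside N_dec)] ->;
    by rewrite (lin0 (tens_linr _)) scaler0.
have zero l : wt_comp M l v = 0 ->
    \sum_(m <- B) c l m *: tens (wt_comp M l v) (wt_comp N m w) = 0.
  by move=> ->; rewrite big1 // => m _; rewrite (lin0 (tens_linl _)) scaler0.
rewrite /wt_scale_pair; under eq_fsbigr do rewrite inner.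
apply: fsbig_wlattice => l => [/vA|/(wt_comp_outside M_dec) l0];
  by move=> *; apply: zero.
Qed.

Lemma wt_scaling_bilinear c : bilinear_map (wt_scale_pair c).
Proof.
split=> [w a v v'|v a w w'].
  have [[A vA] [A' vA']] := (wt_comp_supp M_dec v, wt_comp_supp M_dec v').
  have [B wB] := wt_comp_supp N_dec w.
  have uA l : l \notin (A `|` A')%fset -> wt_comp M l v = 0.
    by rewrite in_fsetU negb_or => /andP[/vA].
  have uA' l : l \notin (A `|` A')%fset -> wt_comp M l v' = 0.
    by rewrite in_fsetU negb_or => /andP[_ /vA'].
  rewrite !(@wt_scale_pairE _ (A `|` A')%fset B) // => [|l lA]; last first.
    by rewrite (wt_comp_linear M_dec) uA // uA' // scaler0 addr0.
  rewrite scaler_sumr -big_split; apply: eq_bigr => l _.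
  rewrite scaler_sumr -big_split; apply: eq_bigr => m _ /=.
  by rewrite (wt_comp_linear M_dec) (tens_linl _) scalerDr !scalerA mulrC.
have [[B wB] [B' wB']] := (wt_comp_supp N_dec w, wt_comp_supp N_dec w').
have [A vA] := wt_comp_supp M_dec v.
have uB l : l \notin (B `|` B')%fset -> wt_comp N l w = 0.
  by rewrite in_fsetU negb_or => /andP[/wB].
have uB' l : l \notin (B `|` B')%fset -> wt_comp N l w' = 0.
  by rewrite in_fsetU negb_or => /andP[_ /wB'].
rewrite !(@wt_scale_pairE _ A (B `|` B')%fset) // => [|l lB]; last first.
  by rewrite (wt_comp_linear N_dec) uB // uB' // scaler0 addr0.
rewrite scaler_sumr -big_split; apply: eq_bigr => l _.
rewrite scaler_sumr -big_split; apply: eq_bigr => m _ /=.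
by rewrite (wt_comp_linear N_dec) (tens_linr _) scalerDr !scalerA mulrC.
Qed.

Lemma wt_scaling_linear c : linear (wt_scaling M N c).
Proof. exact: tlift_linear (wt_scaling_bilinear c). Qed.

Lemma wt_scalingE c l m v w : wlattice l -> wlattice m ->
  wt_space M l v -> wt_space N m w ->
  wt_scaling M N c (tens v w) = c l m *: tens v w.
Proof.
move=> Pl Pm vl wm; rewrite /wt_scaling (tliftE _ _ (wt_scaling_bilinear c)).
rewrite (@wt_scale_pairE _ [fset l]%fset [fset m]%fset).
- by rewrite !big_seq_fset1 (wt_compE M_dec l Pl vl) (wt_compE N_dec m Pm wm) !eqxx.
- by move=> k; rewrite in_fset1 (wt_compE M_dec k Pl vl) => /negPf ->.
- by move=> k; rewrite in_fset1 (wt_compE N_dec k Pm wm) => /negPf ->.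
Qed.

Lemma wt_tensor_ext (X : lmodType K) (f g : tensor V W -> X) :
  linear f -> linear g ->
  (forall l m v w, wlattice l -> wlattice m -> wt_space M l v -> wt_space N m w ->
     f (tens v w) = g (tens v w)) -> f =1 g.
Proof.
move=> fl gl fg.
apply: (tensor_linear_ext fl gl (wt_vectors_span M_dec) (wt_vectors_span N_dec)).
by move=> v w [l Pl vl] [m Pm wm]; apply: fg vl wm.
Qed.

Lemma wt_scalingK c : (forall l m, c l m != 0) ->
  cancel (wt_scaling M N c) (wt_scaling M N (fun l m => (c l m)^-1)).
Proof.
move=> c0; apply: wt_tensor_ext => [a t u|//|l m v w Pl Pm vl wm].
  by rewrite (wt_scaling_linear c) (wt_scaling_linear (fun l m => (c l m)^-1)).
rewrite (wt_scalingE c Pl Pm vl wm) (linZ (wt_scaling_linear _)).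
by rewrite (wt_scalingE _ Pl Pm vl wm) scalerA divff ?scale1r.
Qed.

(** [inverse_of] chooses some preimage: [wt_scalingK] for [c] makes it unique, and [wt_scalingK] for
    the inverse scalars shows that it exists. *)
Lemma inverse_of_wt_scaling c : (forall l m, c l m != 0) ->
  inverse_of (wt_scaling M N c) = wt_scaling M N (fun l m => (c l m)^-1).
Proof.
move=> c0; apply/funext => t; rewrite /inverse_of.
have cK := wt_scalingK c0.
have Kc : wt_scaling M N c (wt_scaling M N (fun l m => (c l m)^-1) t) = t.
  have cV0 l m : (c l m)^-1 != 0 by rewrite invr_neq0.
  have cE : (fun l m => ((c l m)^-1)^-1) = c.
    by apply/funext => l; apply/funext => m; rewrite invrK.
  by have := wt_scalingK cV0 t; rewrite cE.
by case: xgetP => [x _ /= <-|/(_ _ Kc)//]; rewrite cK.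
Qed.

End WeightScaling.

(** * Weight spaces of the twisted module *)

Section TwistedWeights.
Variables (K : fieldType) (D : root_system) (r s : rat -> K).
Hypotheses (rP : power_morph r) (sP : power_morph s).
Hypothesis ratio_inj : forall t, r t * s (- t) = 1 -> t = 0.
Local Notation q := (qpow r s).
Local Notation q' := (qinvpow r s).
Variables (V : lmodType K) (M : uq_module D q q' V) (N : uq_module D r s V).
Hypothesis M_dec : forall v, exists! c, wt_decomposition M v c.
Hypothesis N_twist : is_twist M N.
Implicit Types (l m : wvec D) (v : V).

Lemma ompair_q l m : ompair q q' l m = q (ringel l m + ringel m l).
Proof. by rewrite /ompair /qinvpow opprK (qpow_morph rP sP).1. Qed.

(** Multiplying [ompair] at [(l - l', m)] and at [(m, l - l')] leaves a power of [r/s] whose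
    exponent is the symmetrized Ringel form; [ratio_inj] makes this exponent zero. *)
Lemma ompair_inj l l' m : ompair r s l m = ompair r s l' m ->
  ompair r s m l = ompair r s m l' -> ompair q q' l m = ompair q q' l' m.
Proof.
move=> e1 e2; rewrite !ompair_q; congr (q _).
suff: ringel (l - l') m + ringel m (l - l') = 0.
  by rewrite ringelDl ringelDr ringelNl ringelNr addrACA -opprD => /subr0_eq.
apply: ratio_inj; transitivity (ompair r s (l - l') m * ompair r s m (l - l')).
  by rewrite /ompair opprD rP.1 sP.1; ring.
rewrite ompairDl // ompairDr // ompairNl // ompairNr // e1 e2.
by rewrite !divff ?mulr1 ?ompair_neq0.
Qed.

Lemma wt_space_twist l v : wlattice l -> wt_space M l v -> wt_space N l v.
Proof. by move=> Pl vl i; have [_ _ -> ->] := N_twist i Pl vl. Qed.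

Lemma wt_space_untwist l v : wlattice l -> wt_space N l v -> wt_space M l v.
Proof.
move=> Pl vl; have [A vA] := wt_comp_supp M_dec v.
have vE := wt_decomposition_sum (wt_comp_decomposition M_dec v) vA.
(* The vectors [(d k - c) *: wt_comp M k v] form a weight decomposition of [0], so each of them
   vanishes. *)
have wt_eq m : wt_comp M m v != 0 -> forall c : K, forall d : wvec D -> K,
    \sum_(k <- A) d k *: wt_comp M k v = c *: v -> d m = c.
  move=> vm c d dE; apply/eqP; rewrite -subr_eq0.
  have : (d m - c) *: wt_comp M m v == 0.
    rewrite -[X in X == _](@wt_comp_eq _ _ _ _ _ _ M_dec 0
      (fun k => (d k - c) *: wt_comp M k v)).
      by rewrite (lin0 (wt_comp_linear M_dec m)).
    apply: (@wt_decomposition_intro _ _ _ _ _ _ _ _ A).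
    - by move=> k /vA ->; rewrite scaler0.
    - by move=> k Pk; apply/wt_spaceZ/wt_comp_wt.
    - by move=> k Pk; rewrite (wt_comp_outside M_dec) // scaler0.
    under eq_bigr do rewrite scalerBl.
    by rewrite sumrB dE -scaler_sumr -vE subrr.
  by rewrite scaler_eq0 (negPf vm) orbF.
have act_sum (d : wvec D -> K) u :
    (forall k x, wlattice k -> wt_space M k x -> uact N u x = d k *: x) ->
    \sum_(k <- A) d k *: wt_comp M k v = uact N u v.
  move=> du; rewrite [in RHS]vE (lin_sum (uact_linr N u)).
  apply: eq_bigr => k _; have [Pk|nPk] := pselect (wlattice k).
    by rewrite (du k) //; apply: wt_comp_wt.
  by rewrite (wt_comp_outside M_dec) // scaler0 (lin0 (uact_linr N u)).
have comp0 m : m != l -> wt_comp M m v = 0.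
  move=> ml; apply/eqP; apply: contraNT ml => vm.
  have Pm : wlattice m.
    by apply: contrapT => /(wt_comp_outside M_dec v) vm0; rewrite vm0 eqxx in vm.
  (* [omega_i] and [omega'_i] act on [v] through the weight [l], and on each component through its
     own weight; comparing them gives [m] and [l] the same [(r,s)]-character. *)
  have wl : wt_space M l (wt_comp M m v).
    move=> i; have [vl1 vl2] := vl i.
    have e1 : ompair r s m (alpha i) = ompair r s l (alpha i).
      apply: (wt_eq m vm _ (fun k => ompair r s k (alpha i))).
      rewrite -vl1; apply: act_sum => k x Pk xk.
      by have [_ _ -> _] := N_twist i Pk xk.
    have e2 : (ompair r s (alpha i) m)^-1 = (ompair r s (alpha i) l)^-1.
      apply: (wt_eq m vm _ (fun k => (ompair r s (alpha i) k)^-1)).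
      rewrite -vl2; apply: act_sum => k x Pk xk.
      by have [_ _ _ ->] := N_twist i Pk xk.
    move/invr_inj in e2; have e3 := ompair_inj e1 e2.
    have [-> ->] := wt_comp_wt M_dec v Pm i.
    rewrite e3; split=> //; congr (_^-1 *: _).
    by move: e3; rewrite !ompair_q ![ringel (alpha i) _ + _]addrC.
  (* The component has both weights [l] and [m]: its own component at [m] is itself, but would be
     zero if [m] differed from [l]. *)
  have := wt_compE M_dec m Pl wl; rewrite (wt_compE M_dec m Pm (wt_comp_wt M_dec v Pm)).
  by rewrite eqxx; case: eqP => // _ vm0; rewrite vm0 eqxx in vm.
suff -> : v = wt_comp M l v by apply: wt_comp_wt.
apply/esym; rewrite {2}vE; have [lA|lA] := boolP (l \in A).
  rewrite (big_fsetD1 l) //= big_seq big1 ?addr0 // => m.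
  by rewrite in_fsetD1 => /andP[ml _]; apply: comp0.
rewrite vA // big_seq big1 // => m mA; apply: comp0.
by apply: contraNneq lA => <-.
Qed.

Lemma wt_decomposition_twist v : wt_decomposition N v = wt_decomposition M v.
Proof.
apply/funext => c; apply/propext; split=> -[fc cM cP cE]; split=> // l Pl.
  exact: wt_space_untwist (cM l Pl).
exact: wt_space_twist (cM l Pl).
Qed.

Lemma wt_comp_twist : wt_comp N = wt_comp M.
Proof.
by apply/funext => l; apply/funext => v; rewrite /wt_comp wt_decomposition_twist.
Qed.

End TwistedWeights.

(** * Homogeneous terms of the quasi-R-matrix *)

Section ThetaOperators.
Variables (K : fieldType) (D : root_system) (r s : rat -> K) (H : hopf_data D r s).
Variables (V W : lmodType K) (M : uq_module D r s V) (N : uq_module D r s W).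
Implicit Type b : qplus D.

Definition Theta_term b (t : tensor V W) : tensor V W :=
  \sum_(i < hd_dim H b)
    tmap (uact M (@hd_y _ _ _ _ H b i)) (uact N (@hd_x _ _ _ _ H b i)) t.

Lemma Theta_term_linear b : linear (Theta_term b).
Proof.
move=> a t u; rewrite /Theta_term scaler_sumr -big_split.
by apply: eq_bigr => i _; apply: tmap_linear; apply: uact_linr.
Qed.

Lemma Theta_term_tens b v w : Theta_term b (tens v w) =
  \sum_i tens (uact M (@hd_y _ _ _ _ H b i) v) (uact N (@hd_x _ _ _ _ H b i) w).
Proof. by apply: eq_bigr => i _; apply: tmapE; apply: uact_linr. Qed.

Hypotheses (rP : power_morph r) (sP : power_morph s).

Lemma wt_space_deg_e b l v x :
  usub_deg (@gens_e D) (qvec b) x -> wt_space M l v ->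
  wt_space M (l + qvec b) (uact M x v).
Proof.
move=> /usub_deg_e + vl; elim=> [|a _ y [w wb ->] _ IHy].
  by rewrite (lin0 (uact_linl M v)); apply: wt_space0.
by rewrite (uact_linl M); apply: wt_space_linear => //; rewrite -wb;
  apply: wt_space_eword.
Qed.

Lemma wt_space_deg_f b l v y :
  usub_deg (@gens_f D) (- qvec b) y -> wt_space M l v ->
  wt_space M (l - qvec b) (uact M y v).
Proof.
move=> /usub_deg_f + vl; elim=> [|a _ y' [w wb ->] _ IHy].
  by rewrite (lin0 (uact_linl M v)); apply: wt_space0.
by rewrite (uact_linl M); apply: wt_space_linear => //; rewrite -wb;
  apply: wt_space_fword.
Qed.

End ThetaOperators.

Lemma wlattice_qvec D (b : qplus D) : wlattice (qvec b).
Proof.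
have P0 : wlattice (0 : wvec D) by rewrite -wdeg_nil; apply: wlattice_wdeg.
have -> : qvec b = \sum_i alpha i *+ b i.
  apply/rowP => j; rewrite summxE (big_only1 j) // => [|i ij _].
    by rewrite !mxE mulmxnE mxE !eqxx.
  by rewrite mulmxnE mxE eq_sym (negPf ij) andbF mul0rn.
elim/big_ind: _ => [//|x y|i _]; first exact: wlatticeD.
elim: (b i) => [|k IHk]; first by rewrite mulr0n.
by rewrite mulrS; apply: wlatticeD => //; apply: wlattice_alpha.
Qed.

(** Injectivity spares any finiteness assumption on the support: a sum of
    infinite support is [0] on both sides. *)
Lemma lin_fsbig_inj (K : fieldType) (X Y : lmodType K) (I : choiceType)
    (f : X -> Y) (F : I -> X) : linear f -> injective f ->
  f (\sum_(i \in [set: I]%classic) F i) = \sum_(i \in [set: I]%classic) f (F i).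
Proof.
move=> fl f_inj.
have f0 x : f x = 0 <-> x = 0.
  by split=> [fx0|->]; [apply: f_inj; rewrite fx0|]; rewrite (lin0 fl).
have suppE : ([set: I] `&` (f \o F) @^-1` [set~ 0] =
    [set: I] `&` F @^-1` [set~ 0])%classic.
  by apply/seteqP; split=> i [_ Fi]; split=> // /f0.
have [fin|inf] := pselect (finite_set ([set: I] `&` F @^-1` [set~ 0])%classic).
  have /finite_fsetP[A AE] := fin.
  have FA i : i \notin A -> F i = 0.
    move=> iA; apply: contrapT => Fi; move/negP: iA; apply.
    by have : ([set: I] `&` F @^-1` [set~ 0])%classic i by []; rewrite AE.
  rewrite (@fsbigTE _ _ _ _ A F FA) (@fsbigTE _ _ _ _ A (f \o F)).
    by rewrite (lin_sum fl).
  by move=> i /FA /= ->; rewrite (lin0 fl).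
rewrite !fsbig_dflt ?(lin0 fl) //.
by rewrite -[fun i => f (F i)]/(f \o F) suppE.
Qed.

(** * Conjugation of the intertwiner *)

Section Conjugation.
Variables (K : fieldType) (D : root_system) (r s : rat -> K).
Hypotheses (rP : power_morph r) (sP : power_morph s).
Hypothesis ratio_inj : forall t, r t * s (- t) = 1 -> t = 0.
Local Notation q := (qpow r s).
Local Notation q' := (qinvpow r s).
Variables (Hq : hopf_data D q q') (Hrs : hopf_data D r s).
Variables (V V' : lmodType K).
Variables (M : uq_module D q q' V) (M' : uq_module D q q' V').
Hypothesis M_dec : forall v, exists! c, wt_decomposition M v c.
Hypothesis M'_dec : forall v, exists! c, wt_decomposition M' v c.
Variables (N : uq_module D r s V) (N' : uq_module D r s V').
Hypotheses (N_twist : is_twist M N) (N'_twist : is_twist M' N').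
Implicit Types (l m : wvec D).
Local Notation z := (zeta r s).

(** From here on all components are taken in the original modules, where both sides of the theorem
    can be evaluated on the same weight vectors. *)
Lemma ftilde_twist : ftilde N' N =
  wt_scaling M' M (fun m m' => (ompair r s m' m)^-1).
Proof.
rewrite /ftilde /wt_scaling.
rewrite (wt_comp_twist rP sP ratio_inj M_dec N_twist).
by rewrite (wt_comp_twist rP sP ratio_inj M'_dec N'_twist).
Qed.

Lemma xi_inj : injective (xi M' M).
Proof.
apply: can_inj (wt_scalingK M'_dec M_dec _) => l m.
exact: zeta_neq0.
Qed.

Lemma inverse_of_xi :
  inverse_of (xi M M') = wt_scaling M M' (fun l l' => (z l' l)^-1).
Proof.
by apply: inverse_of_wt_scaling => // l m; apply: zeta_neq0.
Qed.

(** On vectors of weights [l] and [l'], the degree [b] term moves the flipped weights [(l', l)] to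
    [(l' - b, l + b)]. The two maps [xi] thus contribute [zeta(l + b, l' - b) / zeta(l', l) =
    zeta(l, l')^2 zeta(b, l) zeta(b, l')]. The square is the discrepancy of [ompair_twist], the
    other two factors are those of [quasi_R_twist]. *)
Lemma Rhat_term_twist (b : qplus D) t :
  Theta_term Hrs N' N b (ftilde N' N (flip t)) =
  xi M' M (Theta_term Hq M' M b (ftilde M' M (flip (inverse_of (xi M M') t)))).
Proof.
rewrite ftilde_twist inverse_of_xi; move: t.
set c1 := fun m m' => _; set c2 := fun l l' => _.
have lin1 := wt_scaling_linear M'_dec M_dec c1.
have lin2 := wt_scaling_linear M_dec M'_dec c2.
have lin3 := wt_scaling_linear M'_dec M_dec (fun m m' => (ompair q q' m' m)^-1).
have lin4 := wt_scaling_linear M'_dec M_dec (fun l l' => z l' l).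
apply: (wt_tensor_ext M_dec M'_dec) => [a t u|a t u|l l' v v' Pl Pl' vl vl'].
- by rewrite (flip_linear a t) lin1 Theta_term_linear.
- by rewrite lin2 (flip_linear a) /ftilde lin3 Theta_term_linear /xi lin4.
rewrite (wt_scalingE M_dec M'_dec c2 Pl Pl' vl vl').
rewrite (linZ (@flip_linear _ _ _)) !flipE /ftilde (linZ lin3).
rewrite !(wt_scalingE M'_dec M_dec _ Pl' Pl vl' vl) scalerA.
rewrite !(linZ (Theta_term_linear _ _ _ _)) !Theta_term_tens.
rewrite (quasi_R_twist rP sP Hrs Hq b N'_twist N_twist Pl' Pl vl' vl).
rewrite /xi (linZ lin4) (lin_sum lin4).
have Pb := wlattice_qvec b.
have term k : wt_scaling M' M (fun l l' => z l' l)
    (tens (uact M' (@hd_y _ _ _ _ Hq b k) v') (uact M (@hd_x _ _ _ _ Hq b k) v)) =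
  z (l + qvec b) (l' - qvec b) *:
    tens (uact M' (@hd_y _ _ _ _ Hq b k) v') (uact M (@hd_x _ _ _ _ Hq b k) v).
  apply: (wt_scalingE M'_dec M_dec) => //.
  - by apply: wlatticeD => //; apply: wlatticeN.
  - exact: wlatticeD.
  - apply: (wt_space_deg_f (qpow_morph rP sP) (qinvpow_morph rP sP)) => //.
    exact: (hd_yP Hq b).1.
  - apply: (wt_space_deg_e (qpow_morph rP sP) (qinvpow_morph rP sP)) => //.
    exact: (hd_xP Hq b).1.
rewrite (eq_bigr _ (fun k _ => term k)) -scaler_sumr !scalerA; congr (_ *: _).
rewrite /c1 /c2 (ompair_twist rP sP) zetaDl // !zetaDr // !zetaNr // zeta_alt //.
rewrite (zetaC rP sP l (qvec b)) (zetaC rP sP l l').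
have om0 := ompair_neq0 (qpow_morph rP sP) (qinvpow_morph rP sP) l l'.
by field; rewrite oner_neq0 om0 !zeta_neq0.
Qed.

Lemma Rhat_twist :
  Rhat Hrs N N' = xi M' M \o Rhat Hq M M' \o inverse_of (xi M M').
Proof.
apply/funext => t; rewrite /Rhat /Theta /=.
have xi_lin : linear (xi M' M) := wt_scaling_linear M'_dec M_dec _.
rewrite (lin_fsbig_inj _ xi_lin xi_inj).
apply: eq_fsbigr => b _; exact: Rhat_term_twist.
Qed.

End Conjugation.

(** If [(r/s)^t = 1] with [t] nonnegative, raising to the power of the denominator of [t] shows that
    [r0 / s0] to the power of its numerator is [1], so the numerator is zero. Negative [t] are
    handled by passing to the inverse. *)
Lemma power_system_ratio_inj (K : fieldType) (r0 s0 : K) (r s : rat -> K) :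
  power_morph r -> power_morph s -> r 1 = r0 -> s 1 = s0 ->
  (forall k : nat, (0 < k)%N -> (r0 / s0) ^+ k != 1) ->
  forall t, r t * s (- t) = 1 -> t = 0.
Proof.
move=> rP sP <- <- ratio; pose e t := r t * s (- t).
have eP : power_morph e.
  by split=> [t u|]; rewrite /e ?opprD ?rP.1 ?sP.1 ?oppr0 ?rP.2 ?sP.2 ?mulr1 //; ring.
have eX t k : e (t * k%:R) = e t ^+ k.
  elim: k => [|k IHk]; first by rewrite mulr0 eP.2.
  by rewrite -natr1 mulrDr mulr1 eP.1 IHk exprSr.
have e1 k : e k%:R = (r 1 / s 1) ^+ k.
  by rewrite -[k%:R]mul1r eX /e powerN.
have pos t : 0 <= t -> e t = 1 -> t = 0.
  move=> t0 et; have := eX t `|denq t|%N; rewrite et expr1n.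
  have -> : t * `|denq t|%:R = `|numq t|%:R.
    rewrite !natr_absz !intr_norm numqE normrM (ger0_norm t0).
    by rewrite (@ger0_norm _ (denq t)%:~R) // ler0z ltW.
  rewrite e1 => /eqP; apply: contraTeq => tn0; apply: ratio.
  by rewrite absz_gt0 numq_eq0.
move=> t et; have [t0|/ltW t0] := leP 0 t; first exact: pos.
by apply: oppr_inj; rewrite oppr0; apply: pos; rewrite ?oppr_ge0 // powerN //= /e et invr1.
Qed.

Lemma transcendental_neq0 (K : fieldType) (x : K) : transcendental x -> x != 0.
Proof.
move=> /(_ 'X); rewrite map_polyX polyX_eq0 rootX; exact.
Qed.

Theorem proposition3p9 (K : closedFieldType) (D : root_system)
    (r0 s0 : K) (r s : rat -> K)
    (r0_transcendental : transcendental r0)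
    (s0_transcendental : transcendental s0)
    (not_root_of_unity : forall k : nat, (0 < k)%N -> (r0 / s0) ^+ k != 1)
    (r_powers : power_system r0 r) (s_powers : power_system s0 s)
    (Hq : hopf_data D (qpow r s) (qinvpow r s)) (Hrs : hopf_data D r s)
    (V V' : lmodType K)
    (M : uq_module D (qpow r s) (qinvpow r s) V)
    (M' : uq_module D (qpow r s) (qinvpow r s) V')
    (M_in_O : in_category_O M) (M'_in_O : in_category_O M')
    (Mrs : uq_module D r s V) (M'rs : uq_module D r s V')
    (Mrs_twist : is_twist M Mrs) (M'rs_twist : is_twist M' M'rs) :
  Rhat Hrs Mrs M'rs = xi M' M \o Rhat Hq M M' \o inverse_of (xi M M').
Proof.
have rP := power_morph_system (transcendental_neq0 r0_transcendental) r_powers.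
have sP := power_morph_system (transcendental_neq0 s0_transcendental) s_powers.
have [M_dec _ _] := M_in_O; have [M'_dec _ _] := M'_in_O.
apply: Rhat_twist => //.
exact: (power_system_ratio_inj rP sP r_powers.2 s_powers.2 not_root_of_unity).
Qed.
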